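(* Let $a\in\mathbb R\setminus\{0,\tfrac13\}$. The real coefficients $a_{31},a_{32},\beta_2^1,\beta_2^2,\beta_2^3$ for which the commutator-free Runge-Kutta scheme $$g_1=e,\quad g_2=\exp(h\,a f_1),\quad g_3=\exp\big(h(a_{31}f_1+a_{32}f_2)\big),\quad f_r=f(\Lambda(g_r,p))\ (r=1,2,3),$$ $$y_{n+1}=\Lambda\Big(\exp\big(h(\beta_2^1f_1+\beta_2^2f_2+\beta_2^3f_3)\big)\exp\big(h(a_{31}f_1+a_{32}f_2)\big),p\Big)$$ (which reuses the exponential of the third stage as the first exponential of the update) has order $3$ are exactly those of the form $$a_{31}=\frac{6a\nu-3\nu+a}{3a},\qquad a_{32}=\frac{\nu}{a},$$ $$\beta_2^1=\frac{-12a\nu-6\nu+a+1}{6a},\qquad \beta_2^2=\frac{-18a\nu-6\nu+1}{6a(3a-1)},\qquad \beta_2^3=\frac{12\nu+3a-2}{2(3a-1)},$$ where $\nu$ is a real root of $36z^2+(9a-6)z-3a+1$. In this case $c_3:=a_{31}+a_{32}=\frac{6\nu+1}{3}$. Moreover, for such coefficients, with $f_4=f(y_{n+1})$, the embedded approximation $$\hat y_{n+1}=\Lambda\Big(\exp\Big(h\sum_{k=1}^4\hat\beta^kf_k\Big),p\Big)$$ has order $2$ whenever $\sum_{k=1}^4\hat\beta^k=1$ and $a\hat\beta^2+c_3\hat\beta^3+\hat\beta^4=\frac12$, giving embedded pairs of order 3(2).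
   Context: Setting. Let $G$ be a Lie group with Lie algebra $\mathfrak g$ and identity $e$, $M$ a smooth manifold, $\Lambda:G\times M\to M$ a smooth left action with infinitesimal action $\lambda_*(u)(q)=\frac{d}{dt}\big|_{t=0}\Lambda(\exp(tu),q)$, $u\in\mathfrak g$, and $f:M\to\mathfrak g$ smooth. The scheme approximates the solution of $y'=\big(\lambda_*f(y)\big)(y)$ with step size $h$ starting from the point $p=y_n\in M$. Order. Let $\hat\varphi_h:M\to M$ be the map taking $p$ to the approximation computed by one step of a scheme ($y_{n+1}$ or $\hat y_{n+1}$) and $\varphi_h$ the exact time-$h$ flow. The scheme (given by its coefficients) has order $q$ if $\psi(\varphi_h(p))-\psi(\hat\varphi_h(p))=\mathcal O(h^{q+1})$ as $h\to0$ for all $C^\infty$ functions $\psi$ on $M$, all initial points $p$, and all such problems (all $G,M,\Lambda,f$). In particular ''order $q$'' means order at least $q$. An embedded pair of order 3(2) consists of $y_{n+1}$ of order 3 and $\hat y_{n+1}$ of order 2 sharing the same stages; here $\hat y_{n+1}$ may use $f(y_{n+1})$, which is the first function evaluation of the next step (''first same as last''). *)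

(* Defs.v *)
From HB Require Import structures.
From mathcomp Require Import all_boot all_order all_algebra.
From mathcomp Require Import all_classical all_reals all_analysis.

Set Implicit Arguments.
Unset Strict Implicit.
Unset Printing Implicit Defensive.

Import Order.TTheory GRing.Theory Num.Theory.
Import numFieldNormedType.Exports.

Local Open Scope classical_set_scope.
Local Open Scope ring_scope.

(* [U] is meant to be open.  In finite dimension, requiring the continuity of
   the iterated derivatives vector by vector amounts to requiring it in
   operator norm. *)
Fixpoint Ck_on (R : realType) (V W : normedModType R) (k : nat) (U : set V)
    (f : V -> W) : Prop :=
  match k with
  | 0%N => forall x, U x -> {for x, continuous f}
  | k'.+1 => (forall x, U x -> differentiable f x) /\
             (forall v, Ck_on k' U (fun x => 'd f x v))
  end.

Definition smooth_on (R : realType) (V W : normedModType R) (U : set V)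
    (f : V -> W) : Prop := forall k, Ck_on k U f.

(* The values of [chart_map] outside [chart_dom], and of [chart_inv] outside
   the image of [chart_dom], are irrelevant. *)
Record chart (R : realType) (n : nat) (M : topologicalType) := Chart {
  chart_dom : set M;
  chart_map :> M -> 'rV[R]_n;
  chart_inv : 'rV[R]_n -> M }.

Definition is_chart (R : realType) (n : nat) (M : topologicalType)
    (c : chart R n M) : Prop :=
  [/\ open (chart_dom c),
      open (c @` chart_dom c),
      forall x, chart_dom c x -> chart_inv c (c x) = x,
      forall x, chart_dom c x -> {for x, continuous c} &
      forall x, chart_dom c x -> {for c x, continuous (chart_inv c)}].

Definition atlas (R : realType) (n : nat) (M : topologicalType) :=
  set (chart R n M).

Definition is_manifold (R : realType) (n : nat) (M : topologicalType)
    (A : atlas R n M) : Prop :=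
  [/\ hausdorff_space M,
      @second_countable M,
      forall c, A c -> is_chart c,
      forall x, exists2 c, A c & chart_dom c x &
      forall c d, A c -> A d ->
        smooth_on (c @` (chart_dom c `&` chart_dom d)) (d \o chart_inv c)].

Definition prod_chart (R : realType) (m n : nat) (M N : topologicalType)
    (c : chart R m M) (d : chart R n N) : chart R (m + n) (M * N)%type :=
  Chart (chart_dom c `*` chart_dom d)
    (fun z => row_mx (c z.1) (d z.2))
    (fun v => (chart_inv c (lsubmx v), chart_inv d (rsubmx v))).

Definition prod_atlas (R : realType) (m n : nat) (M N : topologicalType)
    (A : atlas R m M) (B : atlas R n N) : atlas R (m + n) (M * N)%type :=
  [set e | exists c d, [/\ A c, B d & e = prod_chart c d]].

Definition smooth_map (R : realType) (m n : nat) (M N : topologicalType)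
    (A : atlas R m M) (B : atlas R n N) (F : M -> N) : Prop :=
  continuous F /\
  forall c d, A c -> B d ->
    smooth_on (c @` (chart_dom c `&` F @^-1` chart_dom d))
              (d \o F \o chart_inv c).

Definition smooth_fun (R : realType) (n : nat) (M : topologicalType)
    (A : atlas R n M) (W : normedModType R) (F : M -> W) : Prop :=
  forall c, A c -> smooth_on (c @` chart_dom c) (F \o chart_inv c).

Definition smooth_curve (R : realType) (n : nat) (M : topologicalType)
    (A : atlas R n M) (g : R -> M) : Prop :=
  continuous g /\ forall c, A c -> smooth_on (g @^-1` chart_dom c) (c \o g).

(* No compatibility between the group law and the topology is built in here:
   it follows from the smoothness required in [is_lie_group]. *)
#[short(type="preTopologicalGroupType")]
HB.structure Definition PreTopologicalGroup :=
  {G of Topological G & Group G}.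

Definition is_lie_group (R : realType) (d : nat) (G : preTopologicalGroupType)
    (A : atlas R d G) : Prop :=
  [/\ is_manifold A,
      smooth_map (prod_atlas A A) A (fun z : G * G => (z.1 * z.2)%g) &
      smooth_map A A (fun x : G => (x^-1)%g)].

(* The Lie algebra T_1 G is identified with R^d by the differential at 1 of the
   chart [c] around 1: [u] stands for the tangent vector with coordinates [u].
   The predicate determines [expG], by uniqueness of one-parameter subgroups. *)
Definition is_exp (R : realType) (d : nat) (G : preTopologicalGroupType)
    (A : atlas R d G) (c : chart R d G) (expG : 'rV[R]_d -> G) : Prop :=
  forall u : 'rV[R]_d,
    [/\ smooth_curve A (fun t : R => expG (t *: u)),
        forall s t : R,
          expG ((s + t) *: u) = (expG (s *: u) * expG (t *: u))%g &
        is_derive (0 : R) 1 (fun t : R => c (expG (t *: u))) u].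

Definition is_smooth_action (R : realType) (d n : nat)
    (G : preTopologicalGroupType) (M : topologicalType) (A : atlas R d G)
    (B : atlas R n M) (L : G -> M -> M) : Prop :=
  [/\ forall q, L 1%g q = q,
      forall x y q, L (x * y)%g q = L x (L y q) &
      smooth_map (prod_atlas A B) B (fun z : G * M => L z.1 z.2)].

Record problem (R : realType) := Problem {
  gdim : nat;
  grp : preTopologicalGroupType;
  gatlas : atlas R gdim grp;
  gchart : chart R gdim grp;
  gexp : 'rV[R]_gdim -> grp;
  mdim : nat;
  mfd : topologicalType;
  matlas : atlas R mdim mfd;
  act : grp -> mfd -> mfd;
  gfun : mfd -> 'rV[R]_gdim;
  grp_lie : is_lie_group gatlas;
  gchart_in : gatlas gchart;
  gchart1 : chart_dom gchart 1%g;
  gexpP : is_exp gatlas gchart gexp;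
  mfdP : is_manifold matlas;
  actP : is_smooth_action gatlas matlas act;
  gfunP : smooth_fun matlas gfun }.

Arguments gexp {R} p.
Arguments matlas {R} p.
Arguments act {R} p.
Arguments gfun {R} p.

(* Coordinates in the chart [c] of the tangent vector lambda_*(u)(q). *)
Definition inf_action (R : realType) (P : problem R) (c : chart R (mdim P) (mfd P))
    (u : 'rV[R]_(gdim P)) (q : mfd P) : 'rV[R]_(mdim P) :=
  'D_1 (fun t : R => c (act P (gexp P (t *: u)) q)) (0 : R).

(* [y] is an integral curve, on some open interval around 0, of the vector
   field q |-> lambda_*(f q)(q): thus y h = phi_h(p) for small h. *)
Definition is_solution (R : realType) (P : problem R) (p : mfd P)
    (y : R -> mfd P) : Prop :=
  y 0 = p /\
  \forall t \near (0 : R), {for t, continuous y} /\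
    forall c, matlas P c -> chart_dom c (y t) ->
      is_derive t 1 (fun s => c (y s)) (inf_action c (gfun P (y t)) (y t)).

Definition scheme (R : realType) := forall P : problem R, R -> mfd P -> mfd P.

Definition has_order (R : realType) (q : nat) (S : scheme R) : Prop :=
  forall (P : problem R) (p : mfd P) (y : R -> mfd P) (psi : mfd P -> R),
    is_solution p y -> smooth_fun (matlas P) psi ->
    (fun h : R => psi (y h) - psi (S P h p)) =O_ (0 : R)
    (fun h : R => h ^+ q.+1).

Definition is_embedded_pair (R : realType) (q q' : nat) (S S' : scheme R) : Prop :=
  has_order q S /\ has_order q' S'.

Section CommutatorFree.
Context {R : realType} (a a31 a32 b1 b2 b3 : R) (P : problem R) (h : R)
  (p : mfd P).

Definition cf_g1 : grp P := 1%g.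
Definition cf_f1 := gfun P (act P cf_g1 p).
Definition cf_g2 := gexp P (h *: (a *: cf_f1)).
Definition cf_f2 := gfun P (act P cf_g2 p).
Definition cf_g3 := gexp P (h *: (a31 *: cf_f1 + a32 *: cf_f2)).
Definition cf_f3 := gfun P (act P cf_g3 p).
Definition cf_step : mfd P :=
  act P (gexp P (h *: (b1 *: cf_f1 + b2 *: cf_f2 + b3 *: cf_f3))%R * cf_g3)%g p.

Definition cf_f4 := gfun P cf_step.
Definition cf_embedded_step (e1 e2 e3 e4 : R) : mfd P :=
  act P (gexp P (h *: (e1 *: cf_f1 + e2 *: cf_f2 + e3 *: cf_f3 + e4 *: cf_f4))) p.
End CommutatorFree.

Definition cf_scheme (R : realType) (a a31 a32 b1 b2 b3 : R) : scheme R :=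
  fun P h p => cf_step a a31 a32 b1 b2 b3 h p.

Definition cf_embedded_scheme (R : realType)
    (a a31 a32 b1 b2 b3 e1 e2 e3 e4 : R) : scheme R :=
  fun P h p => cf_embedded_step a a31 a32 b1 b2 b3 h p e1 e2 e3 e4.

(* Main.v *)
(* The order conditions come from comparing expansions in [h] at the starting
   point [p].  For [u] in the Lie algebra let [X_u] be the fundamental vector
   field of the action, [X_u F (q) = d/dt F (exp (t u) q)] at [t = 0]; it is
   linear in [u] and preserves smooth functions.  With [u = f p], [v = X_u f],
   [w = X_u X_u f] and [x = X_v f] at [p], the exact solution satisfies
     F (y h) = F + h X_u F + h^2/2 (X_v + X_u X_u) F
       + h^3/6 (X_x + X_w + 2 X_u X_v + X_v X_u + X_u X_u X_u) F + O(h^4),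
   while the two exponentials of the update contribute the terms
   [h^(i+j)/(i! j!) X_A^i X_B^j F], where the arguments [A] and [B] of the
   exponentials depend on [h].  Matching coefficients gives five equations for
   the coefficients of the scheme, which are sufficient for order 3.

   They are necessary already for the Heisenberg group acting on itself by left
   translations: in exponential coordinates its exponential map is the identity
   and, for suitable polynomial [f], the solution and the numerical
   approximation are both polynomials in [h].

   Smoothness of [exp] in the Lie algebra variable is never used: continuity at 0
   suffices, since Taylor's formula is applied along one-parameter subgroups
   with a remainder that is uniform on a neighbourhood of [p]. *)

From HB Require Import structures.
Require Import Defs.
From mathcomp Require Import all_boot all_order all_algebra.
From mathcomp Require Import all_classical all_reals all_analysis.
From mathcomp Require Import ring lra.

Set Implicit Arguments.
Unset Strict Implicit.
Unset Printing Implicit Defensive.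

Import Order.TTheory GRing.Theory Num.Theory.
Import numFieldNormedType.Exports.
Local Open Scope classical_set_scope.
Local Open Scope ring_scope.

(** * Calculus of smooth functions *)

Section SmoothCalculus.
Context {R : realType}.

(** The first-order expansion of [f] at [x] is a statement about its germ, so it transfers to [g]; a
    differential is determined by such an expansion. *)
Lemma near_eq_differentiable (V W : normedModType R) (f g : V -> W) (x : V) :
  (\forall y \near x, f y = g y) -> differentiable f x -> differentiable g x /\
  ('d g x = 'd f x :> (V -> W)).
Proof.
move=> fg df; have [cf ef] := (diff_locallyP _ _).1 df.
have gx : g x = f x by apply/esym; exact: nbhs_singleton fg.
have eg : g \o shift x = cst (g x) + 'd f x +o_ (0 : V) id.
  apply/eqaddoP => e e0; move/eqaddoP : ef => /(_ e e0) ef.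
  have fg0 : \forall y \near (0 : V), f (shift x y) = g (shift x y).
    move/nbhs0P : fg; apply: filterS => y; by rewrite /= addrC.
  apply: (filterS2 _ _ fg0 ef) => y fgy; rewrite !fctE /= in fgy *.
  by rewrite -fgy gx.
have dg : 'd g x = 'd f x :> (V -> W) by apply: diff_unique.
split; last exact: dg.
apply: (diff_locallyP _ _).2; rewrite dg; split; [exact: cf|exact: eg].
Qed.

(** Openness turns equality on [U] into equality near each point, hence into equality of the
    differentials on [U], and the induction goes on with these. Later proofs use this to replace a
    derivative by a formula valid on [U] only. *)
Lemma Ck_on_congr (V W : normedModType R) k (U : set V) (f g : V -> W) :
  open U -> (forall x, U x -> f x = g x) -> Ck_on k U f -> Ck_on k U g.
Proof.
move=> oU; elim: k f g => [|k IH] f g fg.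
  move=> cf x Ux; have nfg : \forall y \near x, f y = g y.
    by apply: filterS (open_nbhs_nbhs (conj oU Ux)) => y /fg.
  by apply: cvg_trans (near_eq_cvg _) _; [exact: nfg|rewrite -fg//; exact: cf].
move=> [df cf].
have H x : U x -> differentiable g x /\ ('d g x = 'd f x :> (V -> W)).
  move=> Ux; apply: near_eq_differentiable; last exact: df.
  by apply: filterS (open_nbhs_nbhs (conj oU Ux)) => y /fg.
split=> [x /H[]//|v]; apply: IH (cf v) => x /H[_ ->//].
Qed.

Lemma Ck_onW (V W : normedModType R) k (U : set V) (f : V -> W) :
  Ck_on k.+1 U f -> Ck_on k U f.
Proof.
elim: k f => [|k IH] f [df cf]; first by move=> x /df/differentiable_continuous.
by split=> // v; exact/IH/cf.
Qed.

Lemma Ck_on_sub (V W : normedModType R) k (U U' : set V) (f : V -> W) :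
  U' `<=` U -> Ck_on k U f -> Ck_on k U' f.
Proof.
move=> UU; elim: k f => [|k IH] f /=; first by move=> cf x /UU/cf.
by move=> [df cf]; split=> [x /UU/df//|v]; exact: IH.
Qed.

Lemma Ck_on_cst (V W : normedModType R) k (U : set V) (w : W) :
  Ck_on k U (cst w : V -> W).
Proof.
elim: k w => [|k IH] w /=; first by move=> x _; exact: cst_continuous.
split=> [x _|v]; first exact: differentiable_cst.
have -> : (fun x => 'd (cst w) x v) = cst (0 : W) by apply/funext => x; rewrite diff_cst.
exact: IH.
Qed.

Lemma Ck_on_comp_lin (V W W' : normedModType R) k (U : set V)
    (L : {linear W -> W'}) (f : V -> W) :
  continuous L -> open U -> Ck_on k U f -> Ck_on k U (L \o f).
Proof.
move=> cL oU; elim: k f => [|k IH] f /=.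
  by move=> cf x Ux; apply: continuous_comp; [exact: cf|exact: cL].
move=> [df cf]; split=> [x Ux|v].
  by apply: differentiable_comp; [exact: df|exact: linear_differentiable].
apply: (Ck_on_congr oU) (IH _ (cf v)) => x Ux.
by rewrite diff_comp ?diff_lin //; [exact: df|exact: linear_differentiable].
Qed.

Lemma Ck_onD (V W : normedModType R) k (U : set V) (f g : V -> W) :
  open U -> Ck_on k U f -> Ck_on k U g -> Ck_on k U (f \+ g).
Proof.
move=> oU; elim: k f g => [|k IH] f g /=.
  by move=> cf cg x Ux; apply: cvgD; [exact: cf|exact: cg].
move=> [df cf] [dg cg]; split=> [x Ux|v].
  by apply: differentiableD; [exact: df|exact: dg].
apply: (Ck_on_congr oU) (IH _ _ (cf v) (cg v)) => x Ux.
by rewrite diffD //; [exact: df|exact: dg].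
Qed.

Lemma Ck_on_sum (V W : normedModType R) k (U : set V) n (f : 'I_n -> V -> W) :
  open U -> (forall i, Ck_on k U (f i)) -> Ck_on k U (fun x => \sum_i f i x).
Proof.
move=> oU; elim: n f => [|n IH] f cf.
  apply: (Ck_on_congr oU) (Ck_on_cst k U (0 : W)) => x Ux.
  by rewrite big_ord0.
apply: (Ck_on_congr oU) (Ck_onD oU (IH _ _) (cf ord_max)); last first.
  by move=> i; exact: (cf (widen_ord (leqnSn n) i)).
by move=> x Ux; rewrite big_ord_recr.
Qed.

(** The product rule pairs a derivative of one factor, of class k, with the other factor itself, of
    class k+1; [Ck_onW] brings both to class k. *)
Lemma Ck_onM (V : normedModType R) k (U : set V) (f g : V -> R) :
  open U -> Ck_on k U f -> Ck_on k U g -> Ck_on k U (f \* g).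
Proof.
move=> oU; elim: k f g => [|k IH] f g.
  by move=> cf cg x Ux; apply: cvgM; [exact: cf|exact: cg].
move=> Cf Cg; have [[df cf] [dg cg]] := (Cf, Cg); split=> [x Ux|v].
  by apply: differentiableM; [exact: df|exact: dg].
apply: (Ck_on_congr oU)
  (Ck_onD oU (IH _ _ (Ck_onW Cf) (cg v)) (IH _ _ (Ck_onW Cg) (cf v))) => x Ux.
by rewrite diffM //; [exact: df|exact: dg].
Qed.

Lemma Ck_on_lin (V W : normedModType R) k (U : set V) (L : {linear V -> W}) :
  continuous L -> Ck_on k U L.
Proof.
move=> cL; case: k => [|k] /=; first by move=> x _; exact: cL.
split=> [x _|v]; first exact: linear_differentiable.
have -> : (fun x => 'd L x v) = cst (L v) by apply/funext => x; rewrite diff_lin.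
exact: Ck_on_cst.
Qed.

(** The derivative in direction [v] is ['d f (w + L x) (L v)], again a function composed with the
    same affine map, so the induction closes. It serves to restrict the local expression of the
    action to the slice over the identity. *)
Lemma Ck_on_comp_affine (V W W' : normedModType R) k (U : set V) (U' : set W)
    (L : {linear V -> W}) (w : W) (f : W -> W') :
  continuous L -> open U -> (forall x, U x -> U' (w + L x)) ->
  Ck_on k U' f -> Ck_on k U (fun x => f (w + L x)).
Proof.
move=> cL oU UU'; pose g : V -> W := fun x => w + L x.
have dg x : differentiable g x.
  by apply: (@differentiableD _ _ _ (cst w) L);
    [exact: differentiable_cst|exact: linear_differentiable].
have dgE x : 'd g x = L :> (V -> W).
  rewrite (_ : g = cst w + L) // diffD; [|exact: differentiable_cst|exact:
    linear_differentiable].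
  by rewrite diff_cst diff_lin //; apply/funext => y /=; exact: add0r.
rewrite -[fun _ => _]/(_ \o g).
elim: k f => [|k IH] f.
  move=> cf x Ux; apply: (continuous_comp (f := g)).
    exact/differentiable_continuous.
  exact/cf/UU'.
move=> [df cf]; split=> [x Ux|v].
  by apply: (differentiable_comp (f := g)) => //; exact/df/UU'.
apply: (Ck_on_congr oU) (IH _ (cf (L v))) => x Ux.
have dfx : differentiable f (g x) by exact/df/UU'.
by rewrite diff_comp //= dgE.
Qed.

Lemma is_derive_comp_diff (V W : normedModType R) (g : R -> V) (f : V -> W) (t : R)
  (dg : V) :
  is_derive t 1 g dg -> differentiable f (g t) ->
  is_derive t 1 (f \o g) ('d f (g t) dg).
Proof.
move=> [Dg <-] df; have dg' := (derivable1_diffP _ _).1 Dg.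
have dc := differentiable_comp dg' df.
apply: DeriveDef; first exact: diff_derivable.
by rewrite deriveE // diff_comp //= deriveE.
Qed.

End SmoothCalculus.

(** * Linear maps on row vectors: coordinates and blocks *)

Section RowCalculus.
Context {R : realType}.

Lemma continuous_linear_rV n (W : normedModType R) (L : {linear 'rV[R]_n -> W}) :
  continuous L.
Proof.
have -> : (L : _ -> _) = (fun v : 'rV[R]_n => \sum_j v 0 j *: L (delta_mx 0 j)).
  apply/funext => v; rewrite {1}(row_sum_delta v) linear_sum.
  by apply: eq_bigr => j _; rewrite linearZ.
move=> v; apply: (@Ck_on_sum R _ _ 0 setT n _ openT _ v) => // j {}v _.
have cj : (fun M : 'rV[R]_n => M 0 j) @ nbhs v --> v 0 j by exact: coord_continuous.
exact: (cvgZr_tmp cj).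
Qed.

(** Coordinates and the two block inclusions are bundled as linear maps, so that the lemmas on
    composition with linear and affine maps apply to them. *)
Definition coordf n (j : 'I_n) (v : 'rV[R]_n) : R := v 0 j.
Lemma coordf_is_linear n (j : 'I_n) : linear (coordf j : 'rV[R]_n -> R^o).
Proof. by move=> k u v; rewrite /coordf !mxE. Qed.
HB.instance Definition _ n (j : 'I_n) :=
  GRing.isLinear.Build R 'rV[R]_n R^o _ (coordf j : 'rV[R]_n -> R^o) (coordf_is_linear j).

Definition row_l m n (u : 'rV[R]_m) : 'rV[R]_(m + n) := row_mx u 0.
Lemma row_l_is_linear m n : linear (@row_l m n).
Proof. by move=> k u v; rewrite /row_l scale_row_mx add_row_mx scaler0 addr0. Qed.
HB.instance Definition _ m n :=
  GRing.isLinear.Build R 'rV[R]_m 'rV[R]_(m + n) _ (@row_l m n) (@row_l_is_linear m n).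

Definition row_r m n (u : 'rV[R]_n) : 'rV[R]_(m + n) := row_mx 0 u.
Lemma row_r_is_linear m n : linear (@row_r m n).
Proof. by move=> k u v; rewrite /row_r scale_row_mx add_row_mx scaler0 addr0. Qed.
HB.instance Definition _ m n :=
  GRing.isLinear.Build R 'rV[R]_n 'rV[R]_(m + n) _ (@row_r m n) (@row_r_is_linear m n).

Lemma row_mx_lr m n (u : 'rV[R]_m) (v : 'rV[R]_n) : row_mx u v = row_r m v + row_l n u.
Proof. by rewrite /row_l /row_r add_row_mx addr0 add0r. Qed.

Lemma Ck_on_coord n (V : normedModType R) k (U : set V) (f : V -> 'rV[R]_n) j :
  open U -> Ck_on k U f -> Ck_on k U (fun x => f x 0 j : R).
Proof.
by move=> oU; apply: (@Ck_on_comp_lin _ _ _ _ k U (coordf j : {linear 'rV[R]_n -> R^o}))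
  => //; exact: continuous_linear_rV.
Qed.

Lemma is_derive_comp_shift (V : normedModType R) (f : R -> V) (t : R) (df : V) :
  is_derive (0 : R) 1 f df -> is_derive t 1 (fun s => f (s - t)) df.
Proof.
move=> [Df <-]; have -> : (fun s => f (s - t)) = f \o (fun s => s - t) by [].
have df0 : differentiable f (t - t) by rewrite subrr; apply/derivable1_diffP.
have ds : is_derive (t : R) (1 : R) (fun s : R => s - t) 1.
  by apply: is_derive_eq; rewrite subr0.
have := is_derive_comp_diff ds df0.
by rewrite -deriveE // subrr.
Qed.

End RowCalculus.

(** * Derivatives along the orbits of a smooth action *)

Section ActionCalculus.
Context {R : realType} {d n : nat} {G : preTopologicalGroupType}
  {M : topologicalType} {A : atlas R d G} {B : atlas R n M} {L : G -> M -> M}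
  {c : chart R d G} {expG : 'rV[R]_d -> G}.
Hypotheses (AM : is_manifold A) (BM : is_manifold B) (Ac : A c)
  (c1 : chart_dom c 1%g) (expP : is_exp A c expG) (actL : is_smooth_action A B L).

Lemma atlas_chart e : B e -> is_chart e. Proof. by case: BM => _ _ H _ _; exact: H. Qed.
Lemma atlas_cover q : exists2 e, B e & chart_dom e q. Proof. by case: BM. Qed.
Lemma chartK e q : B e -> chart_dom e q -> chart_inv e (e q) = q.
Proof. by move=> /atlas_chart[_ _ H _ _]; exact: H. Qed.
Lemma gchartK g : chart_dom c g -> chart_inv c (c g) = g.
Proof. by case: AM => _ _ /(_ _ Ac)[_ _ H _ _] _ _; exact: H. Qed.
Lemma act1 q : L 1%g q = q. Proof. by case: actL. Qed.
Lemma actM x y q : L (x * y)%g q = L x (L y q). Proof. by case: actL. Qed.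

Lemma open_near_dom e q : B e -> chart_dom e q -> \forall x \near q, chart_dom e x.
Proof. by move=> /atlas_chart[oe _ _ _ _] eq; exact: open_nbhs_nbhs. Qed.

Lemma exp0 : expG 0 = 1%g.
Proof.
have [_ /(_ 0 0) + _] := expP 0; rewrite !scaler0 => e.
by apply: (mulgI (expG 0)); rewrite -e mulg1.
Qed.

Lemma expD (u : 'rV[R]_d) s t : expG ((s + t) *: u) = (expG (s *: u) * expG (t *: u))%g.
Proof. by have [_ -> _] := expP u. Qed.

Lemma exp_curve_continuous u : continuous (fun t : R => expG (t *: u)).
Proof. by have [[]] := expP u. Qed.

Lemma act_continuous : continuous (fun z : G * M => L z.1 z.2).
Proof. by case: actL => _ _ []. Qed.

Lemma orbit_continuous u q : continuous (fun t : R => L (expG (t *: u)) q).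
Proof.
move=> t; apply: (@continuous_comp _ _ _ (fun t : R => (expG (t *: u), q))
  (fun z : G * M => L z.1 z.2) t).
  by apply: cvg_pair; [exact: exp_curve_continuous|exact: cvg_cst].
exact: act_continuous.
Qed.

Definition act_loc (e : chart R n M) (v : 'rV[R]_(d + n)) : 'rV[R]_n :=
  e (L (chart_inv c (lsubmx v)) (chart_inv e (rsubmx v))).

Definition act_dom (e : chart R n M) : set 'rV[R]_(d + n) :=
  prod_chart c e @` (chart_dom (prod_chart c e) `&`
    (fun z : G * M => L z.1 z.2) @^-1` chart_dom e).

Lemma act_loc_smooth e : B e -> smooth_on (act_dom e) (act_loc e).
Proof.
by move=> Be; case: actL => _ _ [_ H]; apply: H => //; exists c, e.
Qed.

Lemma act_dom1 e q : B e -> chart_dom e q -> act_dom e (row_mx (c 1%g) (e q)).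
Proof. by move=> Be eq; exists (1%g, q) => //=; split=> //=; rewrite act1. Qed.

Lemma act_loc_diff e q : B e -> chart_dom e q ->
  differentiable (act_loc e) (row_mx (c 1%g) (e q)).
Proof. by move=> Be eq; have [+ _] := act_loc_smooth Be 1; apply; exact: act_dom1. Qed.

(** The fundamental vector field of [u] in the chart [e]. Written as a differential of the action at
    the identity, rather than as a derivative along [expG], it is visibly linear in [u] and smooth
    in [z]. *)
Definition vfield (e : chart R n M) (u : 'rV[R]_d) (z : 'rV[R]_n) : 'rV[R]_n :=
  'd (act_loc e) (row_mx (c 1%g) z) (row_l n u).

Lemma vfield_linear e z : linear (vfield e ^~ z).
Proof. by move=> k u v; rewrite /vfield !linearP. Qed.

Lemma vfield_smooth e u : B e -> smooth_on (e @` chart_dom e) (vfield e u).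
Proof.
move=> Be k; have [_ oe _ _ _] := atlas_chart Be.
have [_ /(_ (row_l n u)) H] := act_loc_smooth Be k.+1.
have := @Ck_on_comp_affine R _ _ _ k _ (act_dom e) (@row_r R d n) (row_l n (c 1%g)) _
  (@continuous_linear_rV _ _ _ _) oe _ H.
have -> : vfield e u = (fun x => 'd (act_loc e) (row_l n (c 1%g) + row_r d x) (row_l n u)).
  by apply/funext => x; rewrite /vfield row_mx_lr addrC.
by apply=> _ [q eq <-]; rewrite addrC -row_mx_lr; exact: act_dom1.
Qed.

Lemma exp_dom_near u : \forall t \near (0 : R), chart_dom c (expG (t *: u)).
Proof.
have [_ _ /(_ _ Ac)[oc _ _ _ _] _ _] := AM.
have : \forall g \near expG ((0 : R) *: u), chart_dom c g.
  by rewrite scale0r exp0; exact: open_nbhs_nbhs.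
exact: exp_curve_continuous.
Qed.

Lemma orbit_chart_deriv0 e u q : B e -> chart_dom e q ->
  is_derive (0 : R) 1 (fun t : R => e (L (expG (t *: u)) q)) (vfield e u (e q)).
Proof.
move=> Be eq.
pose g (t : R) : 'rV[R]_(d + n) := row_r d (e q) + row_l n (c (expG (t *: u))).
have g0 : g 0 = row_mx (c 1%g) (e q) by rewrite /g scale0r exp0 -row_mx_lr.
have gd : is_derive (0 : R) 1 g (row_l n u).
  have [_ _ cd] := expP u.
  have := is_derive_comp_diff cd (linear_differentiable (f := @row_l R d n) _
    (@continuous_linear_rV _ _ _ _)).
  rewrite diff_lin; last exact: continuous_linear_rV.
  move=> H; apply: (is_derive_eq (is_deriveD (is_derive_cst (row_r d (e q)) (0 : R)
    (1 : R)) H)).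
  by rewrite add0r.
have := is_derive_comp_diff gd (f := act_loc e).
rewrite g0 => /(_ (act_loc_diff Be eq)); apply: near_eq_is_derive.
have := exp_dom_near u; apply: filterS => t ct.
by rewrite /= /act_loc /g -row_mx_lr row_mxKl row_mxKr gchartK // chartK.
Qed.

(** The one-parameter group law moves the base point to the time [t] point of the orbit, which
    reduces the claim to time 0. *)
Lemma orbit_chart_deriv e u q (t : R) : B e -> chart_dom e (L (expG (t *: u)) q) ->
  is_derive t 1 (fun t : R => e (L (expG (t *: u)) q))
    (vfield e u (e (L (expG (t *: u)) q))).
Proof.
move=> Be eq; have := is_derive_comp_shift t (orbit_chart_deriv0 u Be eq).
rewrite (_ : (fun s : R => _) = (fun s : R => e (L (expG (s *: u)) q))) //.
by apply/funext => s; rewrite -actM -expD subrK.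
Qed.

(** The operator [X_u] applied to [F]. *)
Definition orbit_der (u : 'rV[R]_d) (F : M -> R) (q : M) : R :=
  'D_1 (fun t : R => F (L (expG (t *: u)) q)) (0 : R).

Definition fsmooth (F : M -> R) := smooth_fun B F.

Lemma fsmooth_diff F e q : fsmooth F -> B e -> chart_dom e q ->
  differentiable (F \o chart_inv e) (e q).
Proof. by move=> sF Be eq; have [+ _] := sF e Be 1; apply; exists q. Qed.

Lemma orbit_der_chart F e u q : fsmooth F -> B e -> chart_dom e q ->
  is_derive (0 : R) 1 (fun t : R => F (L (expG (t *: u)) q))
    ('d (F \o chart_inv e) (e q) (vfield e u (e q))).
Proof.
move=> sF Be eq; have H := orbit_chart_deriv0 u Be eq.
have := is_derive_comp_diff H (f := F \o chart_inv e).
rewrite scale0r exp0 act1 => /(_ (fsmooth_diff sF Be eq)); apply: near_eq_is_derive.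
have : \forall x \near L (expG ((0 : R) *: u)) q, chart_dom e x.
  by rewrite scale0r exp0 act1; exact: open_near_dom.
move=> /orbit_continuous od; have {}od : \forall t \near (0 : R),
  chart_dom e (L (expG (t *: u)) q) by exact: od.
by apply: filterS od => t et; rewrite /= chartK.
Qed.

Lemma orbit_derE F e u q : fsmooth F -> B e -> chart_dom e q ->
  orbit_der u F q = 'd (F \o chart_inv e) (e q) (vfield e u (e q)).
Proof. by move=> sF Be eq; have [_] := orbit_der_chart u sF Be eq. Qed.

Lemma orbit_der_deriv0 F u q : fsmooth F ->
  is_derive (0 : R) 1 (fun t : R => F (L (expG (t *: u)) q)) (orbit_der u F q).
Proof.
by move=> sF; have [e Be eq] := atlas_cover q; rewrite (orbit_derE _ sF Be eq);
  exact: orbit_der_chart.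
Qed.

Lemma orbit_der_deriv F u q (t : R) : fsmooth F ->
  is_derive t 1 (fun t : R => F (L (expG (t *: u)) q))
    (orbit_der u F (L (expG (t *: u)) q)).
Proof.
move=> sF; have := is_derive_comp_shift t (orbit_der_deriv0 u (L (expG (t *: u)) q) sF).
rewrite (_ : (fun s : R => _) = (fun s : R => F (L (expG (s *: u)) q))) //.
by apply/funext => s; rewrite -actM -expD subrK.
Qed.

Lemma orbit_der_linear F q : fsmooth F -> linear (fun u => orbit_der u F q : R^o).
Proof.
move=> sF k u v; have [e Be eq] := atlas_cover q.
by rewrite !(orbit_derE _ sF Be eq) vfield_linear linearP.
Qed.

(** In a chart this is the finite sum of the components of [vfield] times the partial derivatives of
    [F], all of them smooth. *)
Lemma orbit_der_smooth F u : fsmooth F -> fsmooth (orbit_der u F).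
Proof.
move=> sF e Be k; have [_ oe _ _ _] := atlas_chart Be.
have [_ cF] := sF e Be k.+1.
apply: (@Ck_on_congr _ _ _ k _ (fun z => \sum_j vfield e u z 0 j * 'd (F \o chart_inv e)
  z (delta_mx 0 j))) => //; last first.
  apply: Ck_on_sum => // j; apply: (@Ck_onM _ _ k _ (fun z => vfield e u z 0 j)) => //;
    last exact: cF.
  by apply: Ck_on_coord => //; exact: vfield_smooth.
move=> _ [q eq <-] /=; rewrite chartK // (orbit_derE _ sF Be eq).
rewrite [in RHS](row_sum_delta (vfield e u (e q))) linear_sum.
by apply: eq_bigr => j _; rewrite linearZ.
Qed.

Lemma fsmoothM F H : fsmooth F -> fsmooth H -> fsmooth (F \* H).
Proof.
move=> sF sH e Be k; have [_ oe _ _ _] := atlas_chart Be.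
exact: Ck_onM oe (sF e Be k) (sH e Be k).
Qed.

Lemma fsmooth_sum m (F : 'I_m -> M -> R) : (forall i, fsmooth (F i)) ->
  fsmooth (fun q => \sum_i F i q).
Proof.
move=> sF e Be k; have [_ oe _ _ _] := atlas_chart Be.
exact: Ck_on_sum oe (fun i => sF i e Be k).
Qed.

Lemma orbit_derM F H u q : fsmooth F -> fsmooth H ->
  orbit_der u (F \* H) q = orbit_der u F q * H q + F q * orbit_der u H q.
Proof.
move=> sF sH; have H1 := orbit_der_deriv0 u q sF; have H2 := orbit_der_deriv0 u q sH.
have [_] := is_deriveM H1 H2; rewrite scale0r exp0 act1 => H3.
by rewrite [LHS]H3 addrC; congr (_ + _); rewrite /GRing.scale /= mulrC.
Qed.

Lemma orbit_der_sum m (F : 'I_m -> M -> R) u q : (forall i, fsmooth (F i)) ->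
  orbit_der u (fun q => \sum_i F i q) q = \sum_i orbit_der u (F i) q.
Proof.
move=> sF; have H i := orbit_der_deriv0 u q (sF i).
have [_ <-] := is_derive_sum (fun i => H i).
by rewrite /orbit_der; congr (derive _ _ _); apply/funext => t; rewrite fct_sumE.
Qed.

Lemma fsmooth_continuous F : fsmooth F -> continuous F.
Proof.
move=> sF q; have [e Be eq] := atlas_cover q.
have [_ _ _ /(_ _ eq) ce _] := atlas_chart Be.
have /differentiable_continuous cF := fsmooth_diff sF Be eq.
have : {for q, continuous ((F \o chart_inv e) \o e)} by exact: continuous_comp.
move=> H; rewrite /continuous_at -{2}(chartK Be eq); apply: cvg_trans H.
apply: near_eq_cvg; have := open_near_dom Be eq; apply: filterS => x ex /=.
by rewrite chartK.
Qed.

End ActionCalculus.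

(** * Real induction, mean value bounds and the Taylor remainder *)

Section RealAnalysis.
Context {R : realType}.

(** Let T be the supremum of the times up to which [P] holds throughout. The hypothesis at T yields
    [P] at T and slightly beyond, so that T cannot stop short of 1. *)
Lemma real_induction (P : R -> Prop) :
  (forall t, 0 <= t <= 1 -> (forall s, 0 <= s < t -> P s) ->
     P t /\ \forall s \near t, P s) ->
  forall t, 0 <= t <= 1 -> P t.
Proof.
move=> H.
pose S : set R := [set t | 0 <= t <= 1 /\ forall s, 0 <= s <= t -> P s].
have P0 : P 0 by have [] := H 0; rewrite ?lexx ?ler01 // => s /andP[/le_lt_trans h /h];
  rewrite ltxx.
have S0 : S 0.
  by split=> [|s]; rewrite ?lexx ?ler01 // -eq_le => /eqP <-.
have Sub : has_ubound S by exists 1 => t [/andP[]].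
have Ssup : has_sup S by split=> //; exists 0.
have T0 : 0 <= sup S by apply: ub_le_sup.
have T1 : sup S <= 1 by apply: ge_sup; [exists 0|move=> t [/andP[]]].
have PT s : 0 <= s < sup S -> P s.
  move=> /andP[s0 sT]; have [t [_ tS] st] := sup_gt (ex_intro _ 0 S0) sT.
  by apply: tS; rewrite s0 ltW.
have [] := H (sup S); first by rewrite T0 T1.
  exact: PT.
move=> PTT /nbhs_ballP[r /= r0 Hr].
have P1 t : 0 <= t -> t < sup S + r -> P t.
  move=> t0 tr; have [tT|tT] := ltP t (sup S); first by apply: PT; rewrite t0.
  by apply: Hr; rewrite /ball /= ltr_distlC; lra.
(* Either [sup S + r / 2] still lies in the unit interval, hence in [S], against the choice of the
   supremum, or [P] is already known on the whole interval. *)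
have [sr|sr] := leP (sup S + r / 2) 1.
  suff : sup S + r / 2 <= sup S by lra.
  apply: ub_le_sup => //; split=> [|s /andP[s0 sS]]; first by apply/andP; split; lra.
  by apply: P1 => //; lra.
by move=> t /andP[t0 t1]; apply: P1 => //; lra.
Qed.

Lemma rV_norm_le m (v : 'rV[R]_m) (K : R) :
  0 <= K -> (forall j, `|v 0 j| <= K) -> `|v| <= K.
Proof.
move=> K0 H; rewrite [leLHS]/Num.Def.normr/= mx_normrE bigmax_le// => -[i j] _ /=.
by rewrite (ord1 i).
Qed.

Lemma rV_coord_le m (v : 'rV[R]_m) j : `|v 0 j| <= `|v|.
Proof.
rewrite [leRHS]/Num.Def.normr/= mx_normrE.
exact: (le_bigmax _ (fun i : 'I_1 * 'I_m => `|v i.1 i.2|) (0, j)).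
Qed.

Lemma is_derive_continuous (f : R -> R) (x df : R) : is_derive x 1 f df ->
  {for x, continuous f}.
Proof. by move=> [Df _]; apply/differentiable_continuous/derivable1_diffP. Qed.

Lemma MVT_closed (f df : R -> R) (a b : R) : a < b ->
  (forall x, a <= x <= b -> is_derive x 1 f (df x)) ->
  exists2 x, a < x < b & f b - f a = df x * (b - a).
Proof.
move=> ab fd; have [||x xab ->] := @MVT R f df a b ab.
- by move=> x; rewrite in_itv /= => /andP[ax xb]; apply: fd; rewrite !ltW.
- apply: continuous_in_subspaceT => x; rewrite inE /= in_itv /= => xab.
  exact: is_derive_continuous (fd _ xab).
- by exists x => //; move: xab; rewrite in_itv.
Qed.

(** The norm of a row vector is the maximum norm, so the mean value theorem can be applied to each
    coordinate. The derivative is bounded strictly inside the interval only, which is all that a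
    continuation argument knows when it reaches the right end. *)
Lemma mean_bound m (z dz : R -> 'rV[R]_m) (a b K : R) : 0 <= K -> a <= b ->
  (forall t, a <= t <= b -> is_derive t 1 z (dz t)) ->
  (forall t, a < t < b -> `|dz t| <= K) -> `|z b - z a| <= K * (b - a).
Proof.
move=> K0 + zd zK; rewrite le_eqVlt => /predU1P[->|ab].
  by rewrite !subrr normr0 mulr0.
apply: rV_norm_le => [|j]; first by rewrite mulr_ge0 // subr_ge0 ltW.
have [t tab|t tab] := @MVT_closed (fun t => z t 0 j) (fun t => dz t 0 j) a b ab.
  have := is_derive_comp_diff (zd t tab) (linear_differentiable (f :=
    coordf j : {linear 'rV[R]_m -> R^o}) _ (@continuous_linear_rV _ _ _ _)).
  by rewrite diff_lin //; exact: continuous_linear_rV.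
rewrite !mxE => ->; rewrite normrM (ger0_norm (x := b - a)) ?subr_ge0 ?(ltW ab) //.
by rewrite ler_wpM2r ?subr_ge0 ?(ltW ab) // (le_trans (rV_coord_le _ _)) // zK.
Qed.

(** Here [phi] lists the successive derivatives of a function. The induction hypothesis, applied to
    the shifted list, bounds the derivative of the remainder, and the mean value theorem integrates
    this bound. *)
Lemma taylor_bound k (phi : nat -> R -> R) (K : R) : 0 <= K ->
  (forall j (t : R), (j < k)%N -> 0 <= t <= 1 -> is_derive t 1 (phi j) (phi j.+1 t)) ->
  (forall t, 0 <= t <= 1 -> `|phi k t| <= K) ->
  forall t : R, 0 <= t <= 1 ->
  `|phi 0%N t - \sum_(j < k) phi j 0 / j`!%:R * t ^+ j| <= K * t ^+ k.
Proof.
move=> K0; elim: k phi => [|k IH] phi dphi Kphi t t01.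
  by rewrite big_ord0 subr0 expr0 mulr1 Kphi.
pose p : {poly R} := \sum_(j < k.+1) (phi j 0 / j`!%:R) *: 'X^j.
have pE s : p.[s] = \sum_(j < k.+1) phi j 0 / j`!%:R * s ^+ j.
  by rewrite horner_sum; apply: eq_bigr => j _; rewrite hornerZ hornerXn.
have p'E s : (p^`()).[s] = \sum_(j < k) phi j.+1 0 / j`!%:R * s ^+ j.
  rewrite linear_sum horner_sum big_ord_recl /= derivZ derivXn mulr0n scaler0 horner0 add0r.
  apply: eq_bigr => j _; rewrite derivZ derivXn hornerZ hornerMn hornerXn /= factS natrM.
  rewrite -mulr_natl; have : j.+1%:R != 0 :> R by rewrite pnatr_eq0.
  have : j`!%:R != 0 :> R by rewrite pnatr_eq0 -lt0n fact_gt0.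
  move=> a0 b0; rewrite /bump /= !add1n add0n -[_ ^+ j *+ _]mulr_natr;
    move: (j.+1%:R : R) (j`!%:R : R) (s ^+ j) (phi j.+1 0) b0 a0 => N Fc x y b0 a0;
    field; by rewrite a0 b0.
have /andP[t0 t1] := t01; move: t0; rewrite le_eqVlt => /predU1P[te|t0].
  rewrite -te -pE horner_coef0 (_ : p`_0 = phi 0%N 0) ?subrr ?normr0 ?exprS ?mul0r
    ?mulr0 //.
  by rewrite -horner_coef0 pE big_ord_recl expr0 fact0 divr1 mulr1 big1 ?addr0 //
    => j _; rewrite exprS mul0r mulr0.
have p0 : p.[0] = phi 0%N 0.
  by rewrite pE big_ord_recl expr0 fact0 divr1 mulr1 big1 ?addr0 // => j _;
    rewrite exprS mul0r mulr0.
have [s s01|s /andP[s0 st]] := @MVT_closed (phi 0%N - horner p)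
  (fun s => phi 1%N s - (p^`()).[s]) 0 t t0.
  have s1 : 0 <= s <= 1 by move: s01 => /andP[-> /le_trans]; exact.
  have := dphi 0%N s (ltn0Sn _) s1 => H; exact: is_deriveB.
rewrite -pE !fctE p0 subrr !subr0 => ->.
have s01 : 0 <= s <= 1 by rewrite ltW // (le_trans (ltW st)).
rewrite normrM (gtr0_norm t0) exprSr mulrA ler_wpM2r ?(ltW t0) //.
have := IH (fun j => phi j.+1) (fun j u jk => dphi j.+1 u jk) Kphi s s01.
rewrite p'E => /le_trans; apply; rewrite ler_wpM2l // lerXn2r ?nnegrE ?(ltW s0)
  ?(ltW t0) ?(ltW st) //.
Qed.

End RealAnalysis.

(** * Local bounds on fundamental fields and continuity of the exponential map at 0 *)

Lemma continuous_norm_lt (R : realType) (T : topologicalType) (W : normedModType R)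
  (f : T -> W) (x : T) (K : R) : {for x, continuous f} -> `|f x| < K ->
  \forall y \near x, `|f y| < K.
Proof.
move=> cf fK; have cn : (fun y => `|f y|) @ x --> `|f x| by exact: cvg_norm.
exact: (cn _ (lt_nbhsl fK)).
Qed.

(** By linearity in [u] it is enough to bound the fields of the finitely many basis vectors, which
    are continuous, on a common neighbourhood. *)
Lemma vfield_bound (R : realType) (d n : nat) (G : preTopologicalGroupType)
  (M : topologicalType) (A : atlas R d G) (B : atlas R n M) (L : G -> M -> M)
  (c : chart R d G) :
  is_manifold B -> A c -> chart_dom c 1%g ->
  is_smooth_action A B L ->
  forall e q, B e -> chart_dom e q -> exists2 K : R, 0 <= K &
    \forall z \near e q, forall u, `|vfield (L := L) (c := c) e u z| <= K * `|u|.
Proof.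
move=> BM Ac c1 actL e q Be eq.
pose v u z := vfield (L := L) (c := c) e u z.
have cv (i : 'I_d) : \forall z \near e q, `|v (delta_mx 0 i) z| <= `|v (delta_mx 0 i)
  (e q)| + 1.
  have cont : {for e q, continuous (v (delta_mx 0 i))}.
    by apply: (vfield_smooth BM Ac c1 actL (delta_mx 0 i) Be 0); exists q.
  have := continuous_norm_lt cont (ltr_pwDr ltr01 (lexx _)).
  by apply: filterS => z /ltW.
have sv z u : v u z = \sum_i u 0 i *: v (delta_mx 0 i) z.
  have lin := @vfield_linear R d n G M L c e z.
  pose vl : {linear 'rV[R]_d -> 'rV[R]_n} := HB.pack_for {linear 'rV[R]_d -> 'rV[R]_n}
    (fun u => v u z) (GRing.isLinear.Build _ _ _ _ _ lin).
  rewrite -[v u z]/(vl u) {1}(row_sum_delta u) linear_sum.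
  by apply: eq_bigr => i _; rewrite linearZ.
exists (\sum_i (`|v (delta_mx 0 i) (e q)| + 1)).
  by apply: sumr_ge0 => i _; rewrite addr_ge0.
have : \forall z \near e q, forall i, `|v (delta_mx 0 i) z| <= `|v (delta_mx 0 i)
  (e q)| + 1.
  exact: (@filter_forall _ 'I_d (fun i z => `|v (delta_mx 0 i) z| <= `|v (delta_mx 0 i)
    (e q)| + 1) (nbhs (e q)) (nbhs_filter _) cv).
apply: filterS => z Hz u.
rewrite -/(v u z) sv mulr_suml; apply: (le_trans (ler_norm_sum _ _ _)).
apply: ler_sum => i _; rewrite normrZ mulrC ler_pM //; exact: rV_coord_le.
Qed.

(* [is_exp] says nothing about the dependence of [expG u] on [u].  As long as
   [t |-> expG (t *: u)] stays in the chart [c], its velocity is [O(`|u|)], so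
   for small [u] it stays close to 1 up to time 1.  It cannot leave the domain
   of the chart either: [N1] and [N2] are neighbourhoods of 1 whose product lies in that
   domain, and [expG (t *: u) = expG ((t - eps) *: u) * expG (eps *: u)]. *)
Lemma exp_continuous0 (R : realType) (d : nat) (G : preTopologicalGroupType)
  (A : atlas R d G) (c : chart R d G) (expG : 'rV[R]_d -> G) :
  is_lie_group A -> A c -> chart_dom c 1%g -> is_exp A c expG ->
  {for 0, continuous expG}.
Proof.
move=> [AM mulA _] Ac c1 expP.
(* The group acts smoothly on itself by left translations, and the orbit of 1 is the exponential
   curve: the lemmas on orbits therefore give its velocity. *)
have actG : is_smooth_action A A (fun x y : G => (x * y)%g).
  by split=> [q|x y q|//]; rewrite ?mul1g ?mulgA.
have expE0 : expG 0 = 1%g := exp0 expP.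
move=> W; rewrite expE0 => nW; rewrite nbhs_simpl /=.
have [K K0 nK] := vfield_bound AM Ac c1 actG Ac c1.
have [_ _ /(_ _ Ac)[oc oic cK cc cic] _ _] := AM.
have nc : nbhs (1%g : G) (chart_dom c) by exact: open_nbhs_nbhs.
have [[N1 N2] /= [nN1 nN2] N12] : nbhs ((1%g, 1%g) : G * G)
  (fun z => chart_dom c (z.1 * z.2)%g).
  have cm : continuous (fun z : G * G => (z.1 * z.2)%g) by case: mulA.
  by apply: cm; rewrite /= mul1g.
have nKc : nbhs (1%g : G) (fun g => forall u, `|vfield (L := fun x y : G => (x * y)%g)
  (c := c) c u (c g)| <= K * `|u|).
  exact: (cc _ c1 _ nK).
have [N nN NP] : exists2 N : set G, nbhs (1%g : G) N & forall g, N g ->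
    [/\ W g, N1 g & forall u, `|vfield (L := fun x y : G => (x * y)%g) (c := c) c u
      (c g)| <= K * `|u|].
  eexists; last by move=> g; exact.
  by near=> g; split; near: g.
have nN' : nbhs (chart_inv c (c 1%g)) N by rewrite cK.
have nNc : \forall z \near c 1%g, N (chart_inv c z) by exact: (cic _ c1 _ nN').
move/nbhs_ballP : nNc => [r /= r0 Hr].
have HN g : chart_dom c g -> `|c g - c 1%g| < r -> N g.
  by move=> cg gr; rewrite -(cK _ cg); apply: Hr; rewrite -ball_normE /= distrC.
(* For u below this radius, K times the norm of u is less than [r], so that the mean value bound
   keeps the curve in the ball of radius [r] up to time 1. Adding 1 to [K] covers the case
   [K = 0]. *)
have d0 : 0 < r / (K + 1) by rewrite divr_gt0 // ltr_wpDl.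
apply/nbhs_ballP; exists (r / (K + 1)) => //= u; rewrite -ball_normE /= sub0r normrN => ur.
have uK : K * `|u| < r.
  rewrite ltr_pdivlMr ?ltr_wpDl // in ur; apply: le_lt_trans ur.
  by rewrite mulrC ler_wpM2l // lerDl.
pose P (t : R) := chart_dom c (expG (t *: u)) /\ `|c (expG (t *: u)) - c 1%g| < r.
suff : P 1 by rewrite /P scale1r => -[c1' /(HN _ c1') /NP[]].
have ec : continuous (fun t : R => expG (t *: u)) by exact: (exp_curve_continuous expP).
apply: real_induction; last by rewrite ler01 lexx.
move=> t /andP[t0 t1] Ps.
have ct : chart_dom c (expG (t *: u)).
  move: t0; rewrite le_eqVlt => /predU1P[<-|t0]; first by rewrite scale0r expE0.
  have : \forall s \near (0 : R), N2 (expG (s *: u)).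
    by have := ec 0; apply; rewrite scale0r expE0.
  move=> /nbhs_ballP[s /= s0 Hs].
  pose eps := Num.min (s / 2) t.
  have e0 : 0 < eps by rewrite lt_min t0 divr_gt0.
  have es : eps <= s / 2 by rewrite ge_min lexx.
  have et : eps <= t by rewrite ge_min lexx orbT.
  rewrite -(subrK eps t) (expD expP); apply: (N12 (_, _)); split => /=.
    by have [a b] := Ps (t - eps) ltac:(lra); have [] := NP _ (HN _ a b).
  by apply: Hs; rewrite /ball /= sub0r normrN gtr0_norm //; lra.
have zd s : 0 <= s <= t -> is_derive s 1 (fun s => c (expG (s *: u)))
    (vfield (L := fun x y : G => (x * y)%g) (c := c) c u (c (expG (s *: u)))).
  move=> /andP[s0]; rewrite le_eqVlt => st.
  have cs : chart_dom c (expG (s *: u)).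
    by move/predU1P : st => [->//|st]; have [] := Ps s; rewrite ?s0.
  have := @orbit_chart_deriv R d d G G A A (fun x y : G => (x * y)%g) c expG AM AM Ac c1
    expP actG c u 1%g s Ac.
  by under eq_fun do rewrite mulg1; rewrite mulg1; exact.
have := mean_bound (K := K * `|u|) (mulr_ge0 K0 (normr_ge0 _)) t0 zd.
rewrite scale0r expE0 subr0 => H.
have Pt : P t.
  split=> //; apply: le_lt_trans (H _) _ => [s /andP[s0 st]|].
    by have [a b] := Ps s ltac:(lra); have [_ _] := NP _ (HN _ a b); exact.
  by apply: le_lt_trans uK; rewrite ler_piMr // mulr_ge0.
split=> //.
have ncc : nbhs (expG (t *: u)) [set g | chart_dom c g /\ `|c g - c 1%g| < r].
  near=> g; split; near: g; first exact: open_nbhs_nbhs.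
  apply: (@continuous_norm_lt _ _ _ (fun g => c g - c 1%g)); last by case: Pt.
  by apply: cvgB; [exact: cc|exact: cvg_cst].
exact: (ec t _ ncc).
Unshelve. all: by end_near. Qed.

(** * Taylor expansions for a fixed problem *)

Section Problem.
Context {R : realType} (P : problem R).
Local Notation V := 'rV[R]_(gdim P).
Local Notation M := (mfd P).
Implicit Types (F H : M -> R) (u w : V) (ws us : seq V) (p q : M).

Definition psmooth F : Prop := smooth_fun (matlas P) F.
Definition pder u F : M -> R := orbit_der (L := act P) (expG := gexp P) u F.
Definition exp_act w q : M := act P (gexp P w) q.

Lemma glie_mfd : is_manifold (@gatlas R P). Proof. by case: (grp_lie P). Qed.

Lemma pder_deriv F u q (t : R) : psmooth F ->
  is_derive t 1 (fun t : R => F (exp_act (t *: u) q)) (pder u F (exp_act (t *: u) q)).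
Proof. exact: (orbit_der_deriv glie_mfd (mfdP P) (gchart_in P) (gchart1 P)
  (gexpP (p:=P)) (actP P)). Qed.

Lemma exp_act0 q : exp_act 0 q = q.
Proof. by rewrite /exp_act (exp0 (gexpP (p:=P))); case: (actP P). Qed.

Lemma pder_linear F q : psmooth F -> linear (fun u => pder u F q : R^o).
Proof. exact: (orbit_der_linear glie_mfd (mfdP P) (gchart_in P) (gchart1 P)
  (gexpP (p:=P)) (actP P)). Qed.

Lemma pder_smooth F u : psmooth F -> psmooth (pder u F).
Proof. exact: (orbit_der_smooth glie_mfd (mfdP P) (gchart_in P) (gchart1 P)
  (gexpP (p:=P)) (actP P)). Qed.

Lemma psmoothM F H : psmooth F -> psmooth H -> psmooth (F \* H).
Proof. exact: (fsmoothM (mfdP P)). Qed.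

Lemma psmooth_sum m (F : 'I_m -> M -> R) : (forall i, psmooth (F i)) ->
  psmooth (fun q => \sum_i F i q).
Proof. exact: (fsmooth_sum (mfdP P)). Qed.

Lemma psmooth_cst (k : R) : psmooth (cst k).
Proof. by move=> e _ j; exact: (Ck_on_cst _ _ (k : R^o)). Qed.

Lemma psmooth_continuous F : psmooth F -> continuous F.
Proof. exact: (fsmooth_continuous (mfdP P)). Qed.

Lemma pderM F H u q : psmooth F -> psmooth H -> pder u (F \* H) q
  = pder u F q * H q + F q * pder u H q.
Proof. exact: (orbit_derM glie_mfd (mfdP P) (gchart_in P) (gchart1 P) (gexpP (p:=P))
  (actP P)). Qed.

Lemma pder_sum m (F : 'I_m -> M -> R) u q : (forall i, psmooth (F i)) ->
  pder u (fun q => \sum_i F i q) q = \sum_i pder u (F i) q.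
Proof. exact: (orbit_der_sum glie_mfd (mfdP P) (gchart_in P) (gchart1 P) (gexpP (p:=P))
  (actP P)). Qed.

Lemma pder_cst (k : R) u q : pder u (cst k) q = 0.
Proof. by rewrite /pder /orbit_der -[RHS](derive_cst (k : R^o) (0 : R) (1 : R)). Qed.

Lemma pder_sumE F u q : psmooth F -> pder u F q = \sum_i u 0 i * pder (delta_mx 0 i) F q.
Proof.
move=> sF; pose l : {linear V -> R^o} := HB.pack_for {linear V -> R^o}
  (fun u => pder u F q : R^o)
  (GRing.isLinear.Build _ _ _ _ _ (pder_linear q sF)).
rewrite -[LHS]/(l u) {1}(row_sum_delta u) linear_sum.
by apply: eq_bigr => i _; rewrite linearZ.
Qed.

Lemma pder_comb m (F : 'I_m -> M -> R) (k : 'I_m -> R) u : (forall i, psmooth (F i)) ->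
  pder u (fun q => \sum_i k i * F i q) = (fun q => \sum_i k i * pder u (F i) q).
Proof.
move=> sF; apply/funext => q; rewrite (@pder_sum _ (fun i => cst (k i) \* F i)).
  by apply: eq_bigr => i _; rewrite pderM ?pder_cst ?mul0r ?add0r //; exact: psmooth_cst.
by move=> i; apply: psmoothM => //; exact: psmooth_cst.
Qed.

(** The head of the word is the outermost operator: [pderw [:: u; v] F] is [X_u X_v F]. *)
Definition pderw ws F := foldr pder F ws.

Lemma pderw_smooth ws F : psmooth F -> psmooth (pderw ws F).
Proof. by move=> sF; elim: ws => //= w ws IH; exact: pder_smooth. Qed.

Lemma pderw_comb m (F : 'I_m -> M -> R) (k : 'I_m -> R) ws : (forall i, psmooth (F i)) ->
  pderw ws (fun q => \sum_i k i * F i q) = (fun q => \sum_i k i * pderw ws (F i) q).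
Proof.
move=> sF; elim: ws => //= w ws ->.
by apply: pder_comb => i; exact: pderw_smooth.
Qed.

(** Expanding the innermost letter in the basis reduces to the finitely many functions
    [pder (delta_mx 0 i) F], whose constants are added and whose neighbourhoods are intersected.
    Uniformity in the word is what later allows directions that depend on the step size. *)
Lemma pderw_bound k F p : psmooth F -> exists2 K : R, 0 <= K &
  \forall q \near p, forall ws, size ws = k -> `|pderw ws F q| <= K * \prod_(w <- ws) `|w|.
Proof.
elim: k F => [|k IH] F sF.
  exists (`|F p| + 1); first by rewrite addr_ge0.
  have cF : {for p, continuous F} by exact: psmooth_continuous.
  have := continuous_norm_lt cF (ltr_pwDr ltr01 (lexx _)).
  apply: filterS => q /ltW Fq ws /size0nil ->; by rewrite big_nil mulr1.
have {}IH (i : 'I_(gdim P)) := IH _ (pder_smooth (delta_mx 0 i) sF).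
pose K i := s2val (cid2 (IH i)); have K0 i : 0 <= K i := s2valP (cid2 (IH i)).
exists (\sum_i K i); first exact: sumr_ge0.
have : \forall q \near p, forall i, forall ws, size ws = k ->
  `|pderw ws (pder (delta_mx 0 i) F) q| <= K i * \prod_(w <- ws) `|w|.
  by apply: filter_forall => i; exact: s2valP' (cid2 (IH i)).
apply: filterS => q Hq; case/lastP => // ws w; rewrite size_rcons => -[sz].
rewrite /pderw foldr_rcons -/(pderw _ _).
have -> : pder w F = (fun q => \sum_i w 0 i * pder (delta_mx 0 i) F q).
  by apply/funext => q'; exact: pder_sumE.
rewrite pderw_comb; last by move=> i; exact: pder_smooth.
rewrite big_rcons /= mulr_suml; apply: (le_trans (ler_norm_sum _ _ _)).
apply: ler_sum => i _; rewrite normrM [K i * _]mulrA mulrC.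
have := Hq i ws sz => H.
rewrite [leRHS](_ : _ = (K i * \prod_(w0 <- ws) `|w0|) * `|w|); last first.
  by ring.
by apply: ler_pM => //; exact: rV_coord_le.
Qed.

Lemma exp_act_near (N : set M) p : nbhs p N ->
  exists2 r : R, 0 < r & exists2 N' : set M, nbhs p N' &
    forall w q, `|w| < r -> N' q -> N (exp_act w q).
Proof.
move=> nN.
have ce := exp_continuous0 (grp_lie P) (gchart_in P) (gchart1 P) (gexpP (p:=P)).
have [_ _ [ca _]] := actP P.
have nN' : nbhs (act P (gexp P 0) p) N by rewrite -/(exp_act 0 p) exp_act0.
have [[N1 N2] /= [nN1 nN2] H] := ca (gexp P 0, p) N nN'.
have /nbhs_ballP[r /= r0 Hr] := ce _ nN1.
exists r => //; exists N2 => // w q wr N2q; apply: (H (_, _)); split=> //=.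
by apply: Hr; rewrite -ball_normE /= sub0r normrN.
Qed.

(** Along the orbit of [w], differentiating a function amounts to putting one more letter [w] in
    front of its word, so [taylor_bound] applies with a remainder controlled by [pderw_bound]. The
    spare word [us] is there for expanding a second exponential. *)
Lemma pderw_taylor k j F p : psmooth F -> exists2 K : R, 0 <= K &
  exists2 r : R, 0 < r & exists2 N : set M, nbhs p N &
    forall w q us, `|w| < r -> N q -> size us = j ->
    `|pderw us F (exp_act w q) - \sum_(i < k) pderw (nseq i w ++ us) F q / i`!%:R|
      <= K * `|w| ^+ k * \prod_(u <- us) `|u|.
Proof.
move=> sF; have [K K0 nK] := pderw_bound (k + j) p sF.
have [r r0 [N nN HN]] := exp_act_near nK.
exists K => //; exists r => //; exists N => // w q us wr Nq szu.
pose phi i (t : R) := pderw (nseq i w ++ us) F (exp_act (t *: w) q).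
have phi0 i : phi i 0 = pderw (nseq i w ++ us) F q by rewrite /phi scale0r exp_act0.
have := @taylor_bound R k phi (K * `|w| ^+ k * \prod_(u <- us) `|u|) _ _ _ 1.
rewrite expr1n mulr1 /phi scale1r /= ler01 lexx.
under [Y in `|_ - Y|]eq_bigr do rewrite scale0r exp_act0 expr1n mulr1.
apply=> //; first by rewrite !mulr_ge0 // ?exprn_ge0 // prodr_ge0.
  by move=> i t _ _; apply: pder_deriv; exact: pderw_smooth.
move=> t /andP[t0 t1].
have tw : `|t *: w| < r by rewrite normrZ ger0_norm // (le_lt_trans _ wr) // ler_piMl.
have := HN _ _ tw Nq (nseq k w ++ us); rewrite size_cat size_nseq szu => /(_ erefl).
by rewrite big_cat /= big_nseq mulrA iter_mulr_1.
Qed.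

(** The derivation along the vector field of the equation. The direction varies with [q], so its
    iterates are not words in a fixed vector: they also involve derivatives of [gfun]. *)
Definition flow_der F q : R := pder (gfun P q) F q.

Lemma gfun_smooth i : psmooth (fun q => gfun P q 0 i).
Proof.
move=> e Be k; have [_ oe _ _ _] := atlas_chart (mfdP P) Be.
exact: Ck_on_coord oe (gfunP Be k).
Qed.

Lemma flow_derE F : psmooth F -> flow_der F = (fun q => \sum_i (gfun P q 0 i) * pder
  (delta_mx 0 i) F q).
Proof. by move=> sF; apply/funext => q; rewrite /flow_der pder_sumE. Qed.

Lemma flow_der_smooth F : psmooth F -> psmooth (flow_der F).
Proof.
move=> sF; rewrite flow_derE //; apply: psmooth_sum => i.
apply: (@psmoothM (fun q => gfun P q 0 i)); [exact: gfun_smooth|exact: pder_smooth].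
Qed.

Lemma sol_deriv F p (y : R -> M) : psmooth F -> is_solution p y ->
  \forall t \near (0 : R), is_derive t (1 : R) (fun t : R => F (y t)) (flow_der F (y t)).
Proof.
move=> sF [_]; apply: filterS => t [cy dy].
have [e Be eq] := atlas_cover (mfdP P) (y t).
have := dy _ Be eq; rewrite /inf_action.
have [_ ->] := orbit_chart_deriv0 glie_mfd (mfdP P) (gchart_in P) (gchart1 P)
  (gexpP (p:=P)) (actP P) (gfun P (y t)) Be eq.
move=> H; have := is_derive_comp_diff H (fsmooth_diff sF Be eq).
rewrite -(orbit_derE glie_mfd (mfdP P) (gchart_in P) (gchart1 P) (gexpP (p:=P))
  (actP P)) //.
apply: near_eq_is_derive.
have nys : \forall s \near t, chart_dom e (y s) := cy _ (open_near_dom (mfdP P) Be eq).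
by apply: filterS nys => s es /=; rewrite (chartK (mfdP P)).
Qed.

Lemma sol_taylor k F p (y : R -> M) : psmooth F -> is_solution p y ->
  exists2 K : R, 0 <= K & \forall h \near (0 : R),
   `|F (y h) - \sum_(i < k) iter i flow_der F p / i`!%:R * h ^+ i| <= K * `|h| ^+ k.
Proof.
move=> sF sol; have [y0 ny] := sol.
have sE i : psmooth (iter i flow_der F) by elim: i => //= i IH; exact: flow_der_smooth.
have cy0 : {for 0, continuous y} by have [] := nbhs_singleton ny.
exists (`|iter k flow_der F p| + 1); first by rewrite addr_ge0.
have nb : \forall t \near (0 : R), `|iter k flow_der F (y t)| < `|iter k flow_der F p| + 1.
  apply: (@continuous_norm_lt _ _ _ (fun t => iter k flow_der F (y t))); last first.
    by rewrite y0 ltrDl.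
  by apply: continuous_comp; [exact: cy0|exact: psmooth_continuous].
have nd : \forall t \near (0 : R), forall i : 'I_k,
  is_derive t (1 : R) (fun t : R => iter i flow_der F (y t)) (iter i.+1 flow_der F (y t)).
  exact: (@filter_forall R 'I_k (fun i t => is_derive t (1 : R)
    (fun t : R => iter i flow_der F (y t)) (iter i.+1 flow_der F (y t)))
    (nbhs (0 : R)) _ (fun i => sol_deriv (sE i) sol)).
have [r /= r0 Hr] := (nbhs_ballP _ _).1 (filterI nb nd).
apply/nbhs_ballP; exists r => //= h; rewrite /ball /= sub0r normrN => hr.
(* Rescaling time by [h] reduces both signs of [h] to Taylor's formula on the unit interval. *)
pose phi i (t : R) := h ^+ i * iter i flow_der F (y (t * h)).
have th t : 0 <= t <= 1 -> ball (0 : R) r (t * h).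
  move=> /andP[t0 t1]; rewrite /ball /= sub0r normrN normrM ger0_norm //.
  by rewrite (le_lt_trans _ hr) // ler_piMl.
have := @taylor_bound R k phi ((`|iter k flow_der F p| + 1) * `|h| ^+ k) _ _ _ 1.
rewrite expr1n mulr1 /phi mul1r expr0 mul1r ler01 lexx.
under [Y in `|_ - Y|]eq_bigr do rewrite mul0r y0 expr1n mulr1 -mulrA mulrC.
apply=> //.
  move=> i t ik t01; have [_ /(_ (Ordinal ik)) /= D] := Hr _ (th _ t01).
  rewrite exprSr -mulrA.
  have dl : is_derive t 1 (fun t : R => t * h) h.
    by apply: is_derive_eq; rewrite scaler0 add0r /GRing.scale /= mulr1.
  have D2 := is_derive_comp_diff dl (f := fun t => iter i flow_der F (y t))
    ((derivable1_diffP _ _).1 (@ex_derive _ _ _ _ _ _ _ D)).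
  have D3 := is_deriveZ (h ^+ i) D2; apply: is_derive_eq D3 _.
  have [D1 D1e] := D.
  have -> : 'd (fun t => iter i flow_der F (y t)) (t * h) h
    = h * iter i.+1 flow_der F (y (t * h)).
    rewrite deriv1E //= -D1e derive1E; congr (_ * _).
  by [].
move=> t t01; have [/ltW ltk _] := Hr _ (th _ t01).
by rewrite normrM normrX mulrC ler_wpM2r ?exprn_ge0.
Qed.

End Problem.

(** * Estimates in powers of the step size *)

Section BigO.
Context {R : realType}.
Implicit Types (W : normedModType R).

(* [bO k f] and [eqO k f g] stand for [f h = O(h^k)] and [f h = g h + O(h^k)]. *)
Definition bO W (k : nat) (f : R -> W) := exists K : R, \forall h \near (0 : R),
  `|f h| <= K * `|h| ^+ k.

Definition eqO W (k : nat) (f g : R -> W) := bO k (fun h => f h - g h).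

Lemma near0_lt (e : R) : 0 < e -> \forall h \near (0 : R), `|h| < e.
Proof.
by move=> e0; apply/nbhs_ballP; exists e => //= h; rewrite /ball /= sub0r normrN.
Qed.

Lemma bO_near W W' k (f : R -> W) (g : R -> W') :
  (\forall h \near (0 : R), `|g h| <= `|f h|) -> bO k f -> bO k g.
Proof. by move=> fg [K fK]; exists K; near=> h; apply: (le_trans (y := `|f h|));
  near: h. Unshelve. all: by end_near. Qed.

Lemma bO_D W k (f g : R -> W) : bO k f -> bO k g -> bO k (fun h => f h + g h).
Proof.
move=> [K fK] [K' gK]; exists (K + K'); near=> h.
by rewrite (le_trans (ler_normD _ _)) // mulrDl lerD //; near: h.
Unshelve. all: by end_near. Qed.

Lemma bO_Z W k (c : R) (f : R -> W) : bO k f -> bO k (fun h => c *: f h).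
Proof.
move=> [K fK]; exists (`|c| * K); near=> h.
by rewrite normrZ -mulrA ler_wpM2l //; near: h.
Unshelve. all: by end_near. Qed.

Lemma bO_hX W j k (f : R -> W) : bO k f -> bO (j + k) (fun h => h ^+ j *: f h).
Proof.
move=> [K fK]; exists K; near=> h.
rewrite normrZ normrX exprD mulrCA ler_wpM2l ?exprn_ge0 //; near: h; exact: fK.
Unshelve. all: by end_near. Qed.

Lemma bO_le W j k (f : R -> W) : (j <= k)%N -> bO k f -> bO j f.
Proof.
move=> jk [K fK]; exists `|K|; near=> h.
have h1 : `|h| <= 1 by apply/ltW; near: h; exact: near0_lt.
apply: (le_trans (y := K * `|h| ^+ k)); first by near: h.
apply: (le_trans (y := `|K| * `|h| ^+ k)); first by rewrite ler_wpM2r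
  ?exprn_ge0 // ler_norm.
by rewrite ler_wpM2l // ler_wiXn2l.
Unshelve. all: by end_near. Qed.

Lemma bO_cst W (c : W) : bO 0 (fun=> c).
Proof. by exists `|c|; near=> h; rewrite expr0 mulr1. Unshelve. all: by end_near. Qed.

Lemma bO_M j k (f g : R -> R) : bO j f -> bO k g -> bO (j + k) (fun h => f h * g h).
Proof.
move=> [K fK] [K' gK]; exists (K * K'); near=> h.
by rewrite normrM exprD mulrACA ler_pM //; near: h.
Unshelve. all: by end_near. Qed.

Lemma bO_rV m k (f : R -> 'rV[R]_m) : (forall i, bO k (fun h => f h 0 i : R^o)) -> bO k f.
Proof.
move=> H; pose K i := sval (cid (H i)).
have fK : \forall h \near (0 : R), forall i, `|f h 0 i| <= K i * `|h| ^+ k.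
  exact: (@filter_forall R 'I_m (fun i h => `|f h 0 i| <= K i * `|h| ^+ k)
    (nbhs (0 : R)) _ (fun i => svalP (cid (H i)))).
exists (\sum_i `|K i|); near=> h.
have fh : forall i, `|f h 0 i| <= K i * `|h| ^+ k by near: h.
apply: rV_norm_le => [|i]; first by rewrite mulr_ge0 ?exprn_ge0 // sumr_ge0.
rewrite (le_trans (fh i)) // ler_wpM2r ?exprn_ge0 // (bigD1 i) //=.
by rewrite (le_trans (ler_norm _)) // lerDl sumr_ge0.
Unshelve. all: by end_near. Qed.

Lemma bO_small W (f : R -> W) (r : R) : bO 0 f -> 0 < r ->
  \forall h \near (0 : R), `|h *: f h| < r.
Proof.
move=> [K fK] r0; near=> h.
have hr : `|h| < r / (`|K| + 1) by near: h; apply: near0_lt; rewrite divr_gt0 // ltr_wpDl.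
have fh : `|f h| <= K * `|h| ^+ 0 by near: h.
rewrite expr0 mulr1 in fh; rewrite ltr_pdivlMr ?ltr_wpDl // in hr.
rewrite normrZ (le_lt_trans _ hr) // ler_wpM2l // (le_trans fh) //
  (le_trans (ler_norm _)) //.
by rewrite lerDl.
Unshelve. all: by end_near. Qed.

Lemma eqO_refl W k (f : R -> W) : eqO k f f.
Proof. by exists 0; near=> h; rewrite subrr normr0 mul0r. Unshelve. all: by end_near. Qed.

Lemma eqO_eq W k (f g : R -> W) : f =1 g -> eqO k f g.
Proof. by move=> /funext ->; exact: eqO_refl. Qed.

Lemma eqO_trans W k (g f f' : R -> W) : eqO k f g -> eqO k g f' -> eqO k f f'.
Proof.
move=> /bO_D H /H; apply: bO_near; near=> h; by rewrite addrA subrK.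
Unshelve. all: by end_near. Qed.

Lemma eqO_D W k (f f' g g' : R -> W) : eqO k f f' -> eqO k g g' ->
  eqO k (fun h => f h + g h) (fun h => f' h + g' h).
Proof.
move=> /bO_D H /H; apply: bO_near; near=> h; by rewrite opprD addrACA.
Unshelve. all: by end_near. Qed.

Lemma eqO_Z W k (c : R) (f g : R -> W) : eqO k f g ->
  eqO k (fun h => c *: f h) (fun h => c *: g h).
Proof.
move=> /(bO_Z c); apply: bO_near; near=> h; by rewrite scalerBr.
Unshelve. all: by end_near. Qed.

Lemma eqO_hX W j k (f g : R -> W) : eqO k f g ->
  eqO (j + k) (fun h => h ^+ j *: f h) (fun h => h ^+ j *: g h).
Proof.
move=> /(bO_hX j); apply: bO_near; near=> h; by rewrite scalerBr.
Unshelve. all: by end_near. Qed.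

Lemma eqO_le W j k (f g : R -> W) : (j <= k)%N -> eqO k f g -> eqO j f g.
Proof. exact: bO_le. Qed.

Lemma eqO_bO W k (f g : R -> W) : eqO k f g -> bO 0 g -> bO 0 f.
Proof.
move=> /(bO_le (leq0n k))/bO_D H /H; apply: bO_near; near=> h; by rewrite subrK.
Unshelve. all: by end_near. Qed.

Lemma eqO_addO W k (f g : R -> W) : bO k g -> eqO k (fun h => f h + g h) f.
Proof.
apply: bO_near; near=> h; by rewrite addrC addKr.
Unshelve. all: by end_near. Qed.

Lemma eqO_sum k m (f g : 'I_m -> R -> R^o) : (forall i, eqO k (f i) (g i)) ->
  eqO k (fun h => \sum_i f i h : R^o) (fun h => \sum_i g i h : R^o).
Proof.
elim: m f g => [|m IH] f g H; first by apply: eqO_eq => h; rewrite !big_ord0.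
apply: eqO_trans (eqO_trans (eqO_D (H ord0) (IH _ _ (fun i => H (lift ord0 i)))) _);
  by apply: eqO_eq => h; rewrite big_ord_recl.
Qed.

Lemma eqO_rV m k (f g : R -> 'rV[R]_m) :
  (forall i, eqO k (fun h => f h 0 i : R^o) (fun h => g h 0 i : R^o)) -> eqO k f g.
Proof.
move=> H; apply: bO_rV => i; have := H i; apply: bO_near; near=> h; by rewrite !mxE.
Unshelve. all: by end_near. Qed.

End BigO.

(** * Multilinearity of iterated derivatives in their directions *)

Section Expansion.
Context {R : realType} (P : problem R).
Local Notation V := 'rV[R]_(gdim P).
Local Notation M := (mfd P).
Implicit Types (F H : M -> R) (u v w : V) (ws us : seq V) (p q : M).

Lemma pder_add (k : R) F H u : psmooth F -> psmooth H ->
  pder u (fun q => k * F q + H q) = (fun q => k * pder u F q + pder u H q).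
Proof.
move=> sF sH; have := @pder_comb R P 2 (fun i : 'I_2 => if i == 0 then F else H)
  (fun i => if i == 0 then k else 1) u.
rewrite (_ : (fun q => \sum_i _) = (fun q => k * F q + H q)); last first.
  by apply/funext => q; rewrite !big_ord_recl big_ord0 /= mul1r addr0.
move=> -> => [|i]; last by case: ifP.
by apply/funext => q; rewrite !big_ord_recl big_ord0 /= mul1r addr0.
Qed.

Lemma pderw_lin (k : R) F u v ws1 ws2 : psmooth F ->
  pderw (ws1 ++ (k *: u + v) :: ws2) F =
  (fun q => k * pderw (ws1 ++ u :: ws2) F q + pderw (ws1 ++ v :: ws2) F q).
Proof.
move=> sF; elim: ws1 => [|w ws1 IH] /=.
  by apply/funext => q; exact: (pder_linear q (pderw_smooth ws2 sF)).
by rewrite IH pder_add //; exact: pderw_smooth.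
Qed.

Lemma pderw_Z (k : R) F u ws1 ws2 q : psmooth F ->
  pderw (ws1 ++ (k *: u) :: ws2) F q = k * pderw (ws1 ++ u :: ws2) F q.
Proof.
(* Additivity with both vectors zero shows that a word containing the letter 0 vanishes. *)
move=> sF; have := pderw_lin 1 0 0 ws1 ws2 sF;
  rewrite scaler0 addr0 => /(congr1 (@^~ q)) /= H0.
have {}H0 : pderw (ws1 ++ 0 :: ws2) F q = 0 by lra.
have := pderw_lin k u 0 ws1 ws2 sF; rewrite addr0 => -> .
by rewrite H0 addr0.
Qed.

Lemma pderw_D F u v ws1 ws2 q : psmooth F ->
  pderw (ws1 ++ (u + v) :: ws2) F q = pderw (ws1 ++ u :: ws2) F q
    + pderw (ws1 ++ v :: ws2) F q.
Proof. by move=> sF; have := pderw_lin 1 u v ws1 ws2 sF; rewrite scale1r => ->;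
  rewrite mul1r. Qed.

Lemma pderw_scale (k : R) F ws q : psmooth F ->
  pderw (map ( *:%R k) ws) F q = k ^+ size ws * pderw ws F q.
Proof.
move=> sF; elim: ws q => [|w ws IH] q; first by rewrite expr0 mul1r.
rewrite -[map _ _]cat0s /= -[LHS]/(pderw ([::] ++ k *: w :: map ( *:%R k) ws) F q)
  pderw_Z //=.
have -> : pderw (map ( *:%R k) ws) F = (cst (k ^+ size ws) \* pderw ws F) by apply/funext.
rewrite pderM ?pder_cst ?mul0r ?add0r ?exprS ?mulrA //;
  [exact: psmooth_cst|exact: pderw_smooth].
Qed.

End Expansion.

(** * Taylor expansion along exponentials whose arguments depend on the step size *)

Section Expansion2.
Context {R : realType} (P : problem R).
Local Notation V := 'rV[R]_(gdim P).
Local Notation M := (mfd P).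
Implicit Types (F H : M -> R) (u v w x : V) (ws us : seq V) (p : M).

Lemma bO0P (W : normedModType R) (f : R -> W) : bO 0 f -> exists2 K : R, 0 <= K &
  \forall h \near (0 : R), `|f h| <= K.
Proof.
move=> [K fK]; exists `|K| => //; near=> h.
have : `|f h| <= K * `|h| ^+ 0 by near: h.
by rewrite expr0 mulr1 => /le_trans; apply; exact: ler_norm.
Unshelve. all: by end_near. Qed.

(** The base point may move with [h] as long as it tends to [p], thanks to the uniform remainder.
    Each letter [h *: B h] contributes a factor [h], whence the order [k + j]. *)
Lemma taylor_eqO k j F p (q : R -> M) (A B : R -> V) : psmooth F ->
  bO 0 A -> bO 0 B -> (forall N, nbhs p N -> \forall h \near (0 : R), N (q h)) ->
  eqO (k + j) (fun h => pderw (nseq j (h *: B h)) F (exp_act (h *: A h) (q h)) : R^o)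
    (fun h => \sum_(i < k) pderw (nseq i (h *: A h) ++ nseq j (h *: B h)) F
      (q h) / i`!%:R : R^o).
Proof.
move=> sF bA bB nq.
have [K K0 [r r0 [N nN H]]] := pderw_taylor k j p sF.
have [KA KA0 nA] := bO0P bA; have [KB KB0 nB] := bO0P bB.
exists (K * KA ^+ k * KB ^+ j); near=> h.
have Ah : `|h *: A h| < r by near: h; exact: bO_small.
have Nq : N (q h) by near: h; exact: nq.
apply: le_trans (H _ _ _ Ah Nq (size_nseq _ _)) _.
rewrite big_nseq iter_mulr_1 !normrZ !exprMn exprD.
have AK : `|A h| <= KA by near: h.
have BK : `|B h| <= KB by near: h.
rewrite [leRHS](_ : _ = K * (`|h| ^+ k * KA ^+ k) * (`|h| ^+ j * KB ^+ j)); last by ring.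
apply: ler_pM.
- by rewrite !mulr_ge0 ?exprn_ge0.
- by rewrite !mulr_ge0 ?exprn_ge0.
- by rewrite ler_wpM2l // ler_wpM2l ?exprn_ge0 // lerXn2r ?nnegrE.
- by rewrite ler_wpM2l ?exprn_ge0 // lerXn2r ?nnegrE.
Unshelve. all: by end_near. Qed.

Lemma exp_act_small p (A : R -> V) : bO 0 A -> forall N, nbhs p N ->
  \forall h \near (0 : R), N (exp_act (h *: A h) p).
Proof.
move=> bA N /exp_act_near[r r0 [N' nN' H]]; near=> h.
by apply: H; [near: h; exact: bO_small|exact: nbhs_singleton].
Unshelve. all: by end_near. Qed.

Lemma one_step k F p (A : R -> V) : psmooth F -> bO 0 A ->
  eqO k (fun h => F (exp_act (h *: A h) p) : R^o)
    (fun h => \sum_(i < k) h ^+ i * (pderw (nseq i (A h)) F p / i`!%:R) : R^o).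
Proof.
move=> sF bA; have := @taylor_eqO k 0 F p (fun=> p) A A sF bA bA _.
rewrite addn0 => /(_ _) => H; apply: eqO_trans (H _) _.
  by move=> N /nbhs_singleton Np; near=> h.
apply: eqO_eq => h; apply: eq_bigr => i _.
by rewrite cats0 -(map_nseq _ ( *:%R h)) pderw_scale // size_nseq mulrA.
Unshelve. all: by end_near. Qed.

(** The outer exponential is expanded first, at the intermediate point, and every resulting function
    [X_B^j F] is then expanded along the inner one. This is why the letters of the inner exponential
    come first in the words. The term with [j] letters [B] already has order [j] and needs only
    [k - j] inner terms. *)
Lemma two_step k F p (A B : R -> V) : psmooth F -> bO 0 A -> bO 0 B ->
  eqO k (fun h => F (exp_act (h *: B h) (exp_act (h *: A h) p)) : R^o)
    (fun h => \sum_(j < k) \sum_(i < k - j) h ^+ (i + j) *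
       (pderw (nseq i (A h) ++ nseq j (B h)) F p / i`!%:R / j`!%:R) : R^o).
Proof.
move=> sF bA bB.
have H1 := @taylor_eqO k 0 F p (fun h => exp_act (h *: A h) p) B B sF bB bB
  (exp_act_small bA).
rewrite addn0 in H1; apply: eqO_trans H1 _.
apply: eqO_sum => j.
have := @taylor_eqO (k - j) j F p (fun=> p) A B sF bA bB _.
rewrite subnK ?(ltnW (ltn_ord j)) // => /(_ _) H2.
apply: (eqO_trans (g := fun h => (j`!%:R)^-1 *: (pderw (nseq j (h *: B h)) F
  (exp_act (h *: A h) p) : R^o))).
  by apply: eqO_eq => h; rewrite cats0 [RHS]mulrC.
apply: eqO_trans (eqO_Z _ (H2 _)) _.
  by move=> N /nbhs_singleton Np; near=> h.
apply: eqO_eq => h; rewrite /GRing.scale /= mulr_sumr; apply: eq_bigr => i _.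
by rewrite -!(map_nseq _ ( *:%R h)) -map_cat pderw_scale // size_cat !size_nseq; ring.
Unshelve. all: by end_near. Qed.

Definition all_bO (As : seq (R -> V)) := foldr (fun A Q => bO 0 A /\ Q) True As.
Definition eval_seq (As : seq (R -> V)) (h : R) : seq V := [seq A h | A <- As].

(** By multilinearity the difference is the word with the letter [A h - A' h], and [pderw_bound]
    estimates it by the product of the norms of the letters. *)
Lemma pderw_repl k F p (As Bs : seq (R -> V)) (A A' : R -> V) : psmooth F ->
  all_bO As -> all_bO Bs -> eqO k A A' ->
  eqO k (fun h => pderw (eval_seq As h ++ A h :: eval_seq Bs h) F p : R^o)
        (fun h => pderw (eval_seq As h ++ A' h :: eval_seq Bs h) F p : R^o).
Proof.
move=> sF bAs bBs eA.
have bprod (Cs : seq (R -> V)) : all_bO Cs -> bO 0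
  (fun h => \prod_(c <- eval_seq Cs h) `|c| : R).
  elim: Cs => [_|C Cs IH [bC /IH {}IH]].
    have := bO_cst (1 : R^o); apply: bO_near; near=> h; by rewrite big_nil.
  have bnC : bO 0 (fun h => `|C h|) by apply: bO_near bC; near=> h; rewrite normr_id.
  have := bO_M bnC IH; apply: bO_near; near=> h; by rewrite /= big_cons.
have [K K0 nK] := pderw_bound (size As + (size Bs).+1) p sF.
have HK := nbhs_singleton nK.
have := bO_Z K (bO_M (bprod _ bAs : bO 0 (fun h => _ : R))
  (bO_M (_ : bO k (fun h => `|A h - A' h|)) (bprod _ bBs))).
rewrite addn0 => H.
have {}H := H _; apply: bO_near (H _); last first.
  by apply: bO_near eA; near=> h; rewrite normr_id.
near=> h.
have -> : pderw (eval_seq As h ++ A h :: eval_seq Bs h) F p - pderw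
  (eval_seq As h ++ A' h :: eval_seq Bs h) F p =
    pderw (eval_seq As h ++ (A h - A' h) :: eval_seq Bs h) F p.
  by have := pderw_D (A h - A' h) (A' h) (eval_seq As h) (eval_seq Bs h) p sF;
    rewrite subrK => ->; rewrite addrK.
apply: le_trans (HK _ _) _; first by rewrite size_cat /= !size_map.
rewrite big_cat big_cons /=.
by rewrite -[leLHS]ger0_norm //; rewrite !mulr_ge0 // prodr_ge0.
Unshelve. all: by end_near. Qed.

Lemma pderw1_eqO k F p (A A' : R -> V) : psmooth F -> eqO k A A' ->
  eqO k (fun h => pderw [:: A h] F p : R^o) (fun h => pderw [:: A' h] F p : R^o).
Proof. by move=> sF; apply: (@pderw_repl k F p [::] [::]). Qed.

Lemma pderw2_eqO k F p (A A' B B' : R -> V) : psmooth F -> bO 0 A -> bO 0 B' ->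
  eqO k A A' -> eqO k B B' ->
  eqO k (fun h => pderw [:: A h; B h] F p : R^o) (fun h => pderw [:: A' h; B' h] F p : R^o).
Proof.
move=> sF bA bB' eA eB.
apply: (eqO_trans (g := (fun h => pderw [:: A h; B' h] F p : R^o))).
  exact: (@pderw_repl k F p [:: A] [::]).
exact: (@pderw_repl k F p [::] [:: B']).
Qed.

(** Telescoping: the letters are replaced one at a time from the right, so boundedness is asked of
    old letters on the left and of new ones on the right. *)
Lemma pderw3_eqO k F p (A A' B B' C C' : R -> V) : psmooth F ->
  bO 0 A -> bO 0 B -> bO 0 B' -> bO 0 C' ->
  eqO k A A' -> eqO k B B' -> eqO k C C' ->
  eqO k (fun h => pderw [:: A h; B h; C h] F p : R^o)
        (fun h => pderw [:: A' h; B' h; C' h] F p : R^o).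
Proof.
move=> sF bA bB bB' bC' eA eB eC.
apply: (eqO_trans (g := (fun h => pderw [:: A h; B h; C' h] F p : R^o))).
  exact: (@pderw_repl k F p [:: A; B] [::]).
apply: (eqO_trans (g := (fun h => pderw [:: A h; B' h; C' h] F p : R^o))).
  exact: (@pderw_repl k F p [:: A] [:: C']).
exact: (@pderw_repl k F p [::] [:: B'; C']).
Qed.

End Expansion2.

(** * Expansions up to order three *)

Section ExactFlow.
Context {R : realType} (P : problem R).
Local Notation V := 'rV[R]_(gdim P).
Local Notation M := (mfd P).
Implicit Types (F H : M -> R) (u v w x : V) (ws us : seq V) (p q : M).

(** Expansion in the basis links a letter frozen at the base point with the coefficient functions
    that [flow_der] differentiates. *)
Lemma pderw_contract F c ws1 ws2 q : psmooth F ->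
  pderw (ws1 ++ c :: ws2) F q = \sum_i c 0 i * pderw (ws1 ++ delta_mx 0 i :: ws2) F q.
Proof.
move=> sF; have sF2 := pderw_smooth ws2 sF.
rewrite /pderw foldr_cat /= -/(pderw ws2 F) -/(pderw ws1 _).
have -> : pder c (pderw ws2 F) = (fun q => \sum_i c 0 i * pder (delta_mx 0 i)
  (pderw ws2 F) q).
  by apply/funext => q'; exact: pder_sumE.
rewrite pderw_comb => [|i]; last exact: pder_smooth.
by apply: eq_bigr => i _; rewrite foldr_cat.
Qed.

Lemma pder_leibniz m (G H : 'I_m -> M -> R) u q :
  (forall i, psmooth (G i)) -> (forall i, psmooth (H i)) ->
  pder u (fun q => \sum_i G i q * H i q) q =
  \sum_i pder u (G i) q * H i q + \sum_i G i q * pder u (H i) q.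
Proof.
move=> sG sH; rewrite (@pder_sum _ _ _ (fun i => G i \* H i)) => [|i]; last exact: psmoothM.
by rewrite -big_split; apply: eq_bigr => i _; rewrite pderM.
Qed.

(** The iterated derivative of the vector-valued [gfun], taken by coordinates. With [u = gfun P p]
    and [v = gvec [:: u] p], the vectors [w] and [x] of the expansions are [gvec [:: u; u] p] and
    [gvec [:: v] p]. *)
Definition gvec ws p : V := \row_i pderw ws (fun q => gfun P q 0 i) p.

Lemma flow_der_iter2 F p : psmooth F ->
  flow_der (flow_der F) p = pderw [:: gvec [:: gfun P p] p] F p + pderw [:: gfun P p;
    gfun P p] F p.
Proof.
move=> sF; rewrite /flow_der -/(flow_der F) (flow_derE sF) pder_leibniz => [|i|i];
  last 2 first.
- exact: gfun_smooth.
- exact: pder_smooth.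
rewrite (pderw_contract _ [::] [::]) // (pderw_contract _ [:: gfun P p] [::]) //;
  congr (_ + _).
by apply: eq_bigr => i _; rewrite mxE.
Qed.

(** Leibniz's rule is applied to the second derivative written in the basis. The term [X_u X_v F]
    comes once from the sum that carries [X_v F] and once from the sum that carries [X_u X_u F],
    hence its coefficient 2. *)
Lemma flow_der_iter3 F p : psmooth F -> let u := gfun P p in let v := gvec [:: u] p in
  flow_der (flow_der (flow_der F)) p = pderw [:: gvec [:: v] p] F p
    + pderw [:: gvec [:: u; u] p] F p +
    2 * pderw [:: u; v] F p + pderw [:: v; u] F p + pderw [:: u; u; u] F p.
Proof.
move=> sF u v.
pose g i q := gfun P q 0 i; have sg i : psmooth (g i) by exact: gfun_smooth.
pose D i : V := delta_mx 0 i.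
(* The factor 1 gives the sum the shape expected by [pder_add]. *)
have -> : flow_der (flow_der F) = (fun q => 1 * (\sum_i flow_der
  (g i) q * pderw [:: D i] F q) +
    \sum_i g i q * (\sum_j g j q * pderw [:: D i; D j] F q)).
  apply/funext => q; rewrite mul1r flow_der_iter2 //; congr (_ + _).
    rewrite (pderw_contract _ [::] [::]) //.
    by apply: eq_bigr => i _; rewrite mxE.
  rewrite (pderw_contract _ [::] [:: _]) //; apply: eq_bigr => i _.
  by rewrite (pderw_contract _ [:: _] [::]).
have sS1 : psmooth (fun q => \sum_i flow_der (g i) q * pderw [:: D i] F q).
  by apply: psmooth_sum => i; apply: psmoothM; [exact: flow_der_smooth|exact: pderw_smooth].
have sK i : psmooth (fun q => \sum_j g j q * pderw [:: D i; D j] F q).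
  by apply: psmooth_sum => j; apply: psmoothM; [exact: sg|exact: pderw_smooth].
have sS2 : psmooth (fun q => \sum_i g i q * (\sum_j g j q * pderw [:: D i; D j] F q)).
  by apply: psmooth_sum => i; apply: psmoothM; [exact: sg|exact: sK].
rewrite /flow_der -/(flow_der _) pder_add // mul1r pder_leibniz; last 2 first.
- by move=> i; exact: flow_der_smooth.
- by move=> i; exact: pderw_smooth.
rewrite pder_leibniz // -/u.
have E1 : \sum_i pder u (flow_der (g i)) p * pderw [:: D i] F p =
    pderw [:: gvec [:: v] p] F p + pderw [:: gvec [:: u; u] p] F p.
  rewrite (pderw_contract (gvec [:: v] p) [::] [::] p sF)
    (pderw_contract (gvec [:: u; u] p) [::] [::] p sF) -big_split; apply: eq_bigr => i _ /=.
  by rewrite !mxE -mulrDl; congr (_ * _); exact: (flow_der_iter2 p (sg i)).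
have E2 : \sum_i flow_der (g i) p * pder u (pderw [:: D i] F) p = pderw [:: u; v] F p.
  by rewrite (pderw_contract _ [:: _] [::]) //; apply: eq_bigr => i _; rewrite mxE.
have E3 : \sum_i pder u (g i) p * (\sum_j g j p * pderw [:: D i; D j] F p)
  = pderw [:: v; u] F p.
  rewrite (pderw_contract _ [::] [:: _]) //; apply: eq_bigr => i _.
  by rewrite mxE (pderw_contract _ [:: _] [::]).
have E4 : \sum_i g i p * pder u (fun q => \sum_j g j q * pderw [:: D i; D j] F q) p =
    pderw [:: u; v] F p + pderw [:: u; u; u] F p.
  rewrite (pderw_contract _ [::] [:: v]) // (pderw_contract _ [:: u] [:: u]) // -big_split.
  apply: eq_bigr => i _ /=; rewrite -mulrDr; congr (_ * _).
  rewrite (pder_leibniz u p sg (fun j => pderw_smooth [:: D i; D j] sF)).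
  apply: (etrans _ (esym (congr2 +%R (pderw_contract v [:: D i] [::] p sF)
    (pderw_contract u [:: u; D i] [::] p sF)))).
  congr (_ + _).
  by apply: eq_bigr => j _; rewrite mxE.
apply: (etrans (congr2 +%R (congr2 +%R E1 E2) (congr2 +%R E3 E4))).
have addE (r1 r2 r3 r4 r5 : R) :
  (r1 + r2 + r3) + (r4 + (r3 + r5)) = r1 + r2 + 2 * r3 + r4 + r5 by ring.
exact: addE.
Qed.

End ExactFlow.

Lemma double_taylor4 (R : realType) (T : nat -> nat -> R) (h : R) :
  \sum_(j < 4) \sum_(i < 4 - j) h ^+ (i + j) * (T i j / i`!%:R / j`!%:R) =
  T 0%N 0%N + (h ^+ 1 * T 1%N 0%N + (h ^+ 1 * T 0%N 1%N +
  (h ^+ 2 * (2^-1 * T 2%N 0%N) + (h ^+ 2 * T 1%N 1%N + (h ^+ 2 * (2^-1 * T 0%N 2%N) +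
  (h ^+ 3 * (6^-1 * T 3%N 0%N) + (h ^+ 3 * (2^-1 * T 2%N 1%N) +
  (h ^+ 3 * (2^-1 * T 1%N 2%N) + h ^+ 3 * (6^-1 * T 0%N 3%N))))))))).
Proof.
rewrite !big_ord_recl !big_ord0 /= /bump /= !(factS, fact0).
by field.
Qed.

Lemma two_step_identity (R : realType)
  (h al be nu m ka la mu f0 tu tv tw tx tuu tuv tvu tvv tuuu : R) :
  f0 +
  (h ^+ 1 * (al * tu + h * nu * tv + h ^+ 2 * ka * tw) +
   (h ^+ 1 *
    (be * tu + h * m * tv +
     (h ^+ 2 * la * tw + h ^+ 2 * mu * tx)) +
    (h ^+ 2 *
     (2^-1 *
      (al * (al * tuu) + al * (h * nu * tuv) +
       (h * nu * (al * tvu) + h * nu * (h * nu * tvv)))) +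
     (h ^+ 2 *
      (al * (be * tuu) + al * (h * m * tuv) +
       (h * nu * (be * tvu) + h * nu * (h * m * tvv))) +
      (h ^+ 2 *
       (2^-1 *
        (be * (be * tuu) + be * (h * m * tuv) +
         (h * m * (be * tvu) + h * m * (h * m * tvv)))) +
       (h ^+ 3 * (6^-1 * (al * (al * (al * tuuu)))) +
        (h ^+ 3 * (2^-1 * (al * (al * (be * tuuu)))) +
         (h ^+ 3 * (2^-1 * (al * (be * (be * tuuu)))) +
          h ^+ 3 * (6^-1 * (be * (be * (be * tuuu))))))))))))
  = f0 + h * ((al + be) * tu) +
      h ^+ 2 * ((nu + m) * tv + (al + be) ^+ 2 / 2 * tuu) +
      h ^+ 3 * ((ka + la) * tw + mu * tx +
         (al * nu / 2 + al * m + be * m / 2) * tuv +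
         (al * nu / 2 + nu * be + be * m / 2) * tvu +
         (al + be) ^+ 3 / 6 * tuuu) +
      h ^+ 4 * ((nu ^+ 2 + m ^+ 2) / 2 + nu * m) * tvv.
Proof. by field. Qed.

(** * Expansions of one and two exponentials in elementary differentials *)

Section Coefficients.
Context {R : realType} (P : problem R).
Local Notation V := 'rV[R]_(gdim P).
Local Notation M := (mfd P).
Context (F : M -> R) (p : M) (sF : psmooth F).
Implicit Types (u v w x : V).

Lemma pder1D u v : pderw [:: u + v] F p = pderw [:: u] F p + pderw [:: v] F p.
Proof. exact: (pderw_D _ _ [::] [::]). Qed.
Lemma pder1Z (k : R) u : pderw [:: k *: u] F p = k * pderw [:: u] F p.
Proof. exact: (pderw_Z _ _ [::] [::]). Qed.
Lemma pder2Dl u v w : pderw [:: u + v; w] F p = pderw [:: u; w] F p + pderw [:: v; w] F p.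
Proof. exact: (pderw_D _ _ [::] [:: _]). Qed.
Lemma pder2Dr u v w : pderw [:: w; u + v] F p = pderw [:: w; u] F p + pderw [:: w; v] F p.
Proof. exact: (pderw_D _ _ [:: _] [::]). Qed.
Lemma pder2Zl (k : R) u w : pderw [:: k *: u; w] F p = k * pderw [:: u; w] F p.
Proof. exact: (pderw_Z _ _ [::] [:: _]). Qed.
Lemma pder2Zr (k : R) u w : pderw [:: w; k *: u] F p = k * pderw [:: w; u] F p.
Proof. exact: (pderw_Z _ _ [:: _] [::]). Qed.
Lemma pder3Z1 (k : R) u v w : pderw [:: k *: u; v; w] F p = k * pderw [:: u; v; w] F p.
Proof. exact: (pderw_Z _ _ [::] [:: _; _]). Qed.
Lemma pder3Z2 (k : R) u v w : pderw [:: u; k *: v; w] F p = k * pderw [:: u; v; w] F p.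
Proof. exact: (pderw_Z _ _ [:: _] [:: _]). Qed.
Lemma pder3Z3 (k : R) u v w : pderw [:: u; v; k *: w] F p = k * pderw [:: u; v; w] F p.
Proof. exact: (pderw_Z _ _ [:: _; _] [::]). Qed.
Definition pderwE := (pder1D, pder1Z, pder2Dl, pder2Dr, pder2Zl, pder2Zr, pder3Z1,
  pder3Z2, pder3Z3).

Lemma bO_hXc (W : normedModType R) j (c : R) (w : W) : bO j (fun h => (h ^+ j * c) *: w).
Proof.
have := bO_hX j (bO_cst (c *: w)); rewrite addn0; apply: bO_near.
by near=> h; rewrite scalerA.
Unshelve. all: by end_near. Qed.

Lemma bO_hc (W : normedModType R) (c : R) (w : W) : bO 1 (fun h => (h * c) *: w).
Proof. exact: (bO_hXc 1). Qed.

Lemma eqO_lin0 (A : R -> V) (al nu : R) u v :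
  eqO 2 A (fun h => al *: u + (h * nu) *: v) -> eqO 1 A (fun=> al *: u).
Proof. by move=> /(eqO_le (leqnSn 1)) H; apply: eqO_trans H (eqO_addO _ (bO_hc _ _)). Qed.

Lemma eqO1_bO (A : R -> V) (w : V) : eqO 1 A (fun=> w) -> bO 0 A.
Proof. by move=> /eqO_bO; apply; exact: bO_cst. Qed.

Lemma one_step_exp (A : R -> V) (al nu : R) u v :
  eqO 2 A (fun h => al *: u + (h * nu) *: v) ->
  eqO 3 (fun h => F (exp_act (h *: A h) p) : R^o)
    (fun h => F p + h * (al * pderw [:: u] F p) +
      h ^+ 2 * (nu * pderw [:: v] F p + al ^+ 2 / 2 * pderw [:: u; u] F p) : R^o).
Proof.
move=> eA; have eA1 := eqO_lin0 eA; have bA := eqO1_bO eA1.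
apply: eqO_trans (one_step 3 p sF bA) _.
apply: (eqO_trans (g := fun h => (F p : R^o) + (h ^+ 1 *: (pderw [:: A h] F p : R^o) +
    h ^+ 2 *: (2^-1 *: (pderw [:: A h; A h] F p : R^o))))).
  apply: eqO_eq => h; rewrite !big_ord_recl big_ord0 /=.
  by rewrite /GRing.scale /= /bump /= !(factS, fact0); field.
apply: eqO_trans (eqO_D (eqO_refl _ _) (eqO_D (eqO_hX 1 (pderw1_eqO p sF eA))
  (eqO_hX 2 (eqO_Z 2^-1 (pderw2_eqO p sF bA (bO_cst _) eA1 eA1))))) _.
by apply: eqO_eq => h; rewrite !pderwE /GRing.scale /= expr1; field.
Qed.

Lemma two_step_exp2 (A B : R -> V) (al be : R) u :
  eqO 1 A (fun=> al *: u) -> eqO 1 B (fun=> be *: u) ->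
  eqO 2 (fun h => F (exp_act (h *: B h) (exp_act (h *: A h) p)) : R^o)
    (fun h => F p + h * ((al + be) * pderw [:: u] F p) : R^o).
Proof.
move=> eA eB; have bA := eqO1_bO eA; have bB := eqO1_bO eB.
apply: eqO_trans (two_step 2 p sF bA bB) _.
apply: (eqO_trans (g := fun h => (F p : R^o) + (h ^+ 1 *: (pderw [:: A h] F p : R^o) +
    h ^+ 1 *: (pderw [:: B h] F p : R^o)))).
  apply: eqO_eq => h; rewrite !big_ord_recl !big_ord0 /=.
  by rewrite /GRing.scale /= /bump /= !(factS, fact0); field.
apply: eqO_trans (eqO_D (eqO_refl _ _) (eqO_D (eqO_hX 1 (pderw1_eqO p sF eA))
  (eqO_hX 1 (pderw1_eqO p sF eB)))) _.
by apply: eqO_eq => h; rewrite !pderwE /GRing.scale /= expr1; ring.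
Qed.

(* In the application [A] and [B] are the arguments of the two exponentials of the
   update; [A] comes from the third stage and has no [x] component. *)
Lemma two_step_exp4 (A B : R -> V) (al be nu m ka la mu : R) u v w x :
  eqO 3 A (fun h => al *: u + (h * nu) *: v + (h ^+ 2 * ka) *: w) ->
  eqO 3 B (fun h => be *: u + (h * m) *: v + ((h ^+ 2 * la) *: w + (h ^+ 2 * mu) *: x)) ->
  eqO 4 (fun h => F (exp_act (h *: B h) (exp_act (h *: A h) p)) : R^o)
    (fun h => F p + h * ((al + be) * pderw [:: u] F p) +
      h ^+ 2 * ((nu + m) * pderw [:: v] F p + (al + be) ^+ 2 / 2 * pderw [:: u; u] F p) +
      h ^+ 3 * ((ka + la) * pderw [:: w] F p + mu * pderw [:: x] F p +
         (al * nu / 2 + al * m + be * m / 2) * pderw [:: u; v] F p +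
         (al * nu / 2 + nu * be + be * m / 2) * pderw [:: v; u] F p +
         (al + be) ^+ 3 / 6 * pderw [:: u; u; u] F p) : R^o).
Proof.
move=> eA eB.
have eA2 : eqO 2 A (fun h => al *: u + (h * nu) *: v).
  by apply: eqO_trans (eqO_le (leqnSn 2) eA) (eqO_addO _ (bO_hXc 2 _ _)).
have eB2 : eqO 2 B (fun h => be *: u + (h * m) *: v).
  by apply: eqO_trans (eqO_le (leqnSn 2) eB) (eqO_addO _
    (bO_D (bO_hXc 2 _ _) (bO_hXc 2 _ _))).
have eA1 := eqO_lin0 eA2; have bA := eqO1_bO eA1.
have eB1 := eqO_lin0 eB2; have bB := eqO1_bO eB1.
have bA2 : bO 0 (fun h => al *: u + (h * nu) *: v).
  by apply: bO_D (bO_cst _) (bO_le (leq0n 1) (bO_hc _ _)).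
have bB2 : bO 0 (fun h => be *: u + (h * m) *: v).
  by apply: bO_D (bO_cst _) (bO_le (leq0n 1) (bO_hc _ _)).
have cA := bO_cst (al *: u); have cB := bO_cst (be *: u).
apply: eqO_trans (two_step 4 p sF bA bB) _.
apply: (eqO_trans (g := fun h => (F p : R^o) + (h ^+ 1 *: (pderw [:: A h] F p : R^o) +
    (h ^+ 1 *: (pderw [:: B h] F p : R^o) +
    (h ^+ 2 *: (2^-1 *: (pderw [:: A h; A h] F p : R^o)) +
    (h ^+ 2 *: (pderw [:: A h; B h] F p : R^o) +
    (h ^+ 2 *: (2^-1 *: (pderw [:: B h; B h] F p : R^o)) +
    (h ^+ 3 *: (6^-1 *: (pderw [:: A h; A h; A h] F p : R^o)) +
    (h ^+ 3 *: (2^-1 *: (pderw [:: A h; A h; B h] F p : R^o)) +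
    (h ^+ 3 *: (2^-1 *: (pderw [:: A h; B h; B h] F p : R^o)) +
     h ^+ 3 *: (6^-1 *: (pderw [:: B h; B h; B h] F p : R^o)))))))))))).
  apply: eqO_eq => h.
  exact: (double_taylor4 (fun i j => pderw (nseq i (A h) ++ nseq j (B h)) F p) h).
(* A word of length j carries the factor h^j, so its letters matter only modulo h^(4-j). *)
apply: eqO_trans (eqO_D (eqO_refl _ _) (eqO_D (eqO_hX 1 (pderw1_eqO p sF eA))
  (eqO_D (eqO_hX 1 (pderw1_eqO p sF eB))
  (eqO_D (eqO_hX 2 (eqO_Z 2^-1 (pderw2_eqO p sF bA bA2 eA2 eA2)))
  (eqO_D (eqO_hX 2 (pderw2_eqO p sF bA bB2 eA2 eB2))
  (eqO_D (eqO_hX 2 (eqO_Z 2^-1 (pderw2_eqO p sF bB bB2 eB2 eB2)))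
  (eqO_D (eqO_hX 3 (eqO_Z 6^-1 (pderw3_eqO p sF bA bA cA cA eA1 eA1 eA1)))
  (eqO_D (eqO_hX 3 (eqO_Z 2^-1 (pderw3_eqO p sF bA bA cA cB eA1 eA1 eB1)))
  (eqO_D (eqO_hX 3 (eqO_Z 2^-1 (pderw3_eqO p sF bA bB cB cB eA1 eB1 eB1)))
    (eqO_hX 3 (eqO_Z 6^-1 (pderw3_eqO p sF bB bB cB cB eB1 eB1 eB1)))))))))))) _.
(* The products of two [v] terms are the only ones of order 4 left; they go into the error. *)
have := bO_hXc 4 ((nu ^+ 2 + m ^+ 2) / 2 + nu * m) (pderw [:: v; v] F p : R^o) => H.
apply: eqO_trans (eqO_addO _ H); apply: eqO_eq => h.
rewrite !pderwE /GRing.scale /=; exact: two_step_identity.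
Qed.

End Coefficients.

(** * Sufficiency of the order conditions *)

Lemma order2_identity (R : realType) (h f0 tu tv tuu : R) :
  f0 + h * (1 * tu) + h ^+ 2 * (1 / 2 * tv + 1 ^+ 2 / 2 * tuu) =
  f0 + h * tu + h ^+ 2 / 2 * (tv + tuu).
Proof. by field. Qed.

Lemma order3_identity (R : realType) (h f0 tu tv tw tx tuu tuv tvu tuuu : R) :
  f0 + h * (1 * tu) + h ^+ 2 * (1 / 2 * tv + 1 ^+ 2 / 2 * tuu) +
    h ^+ 3 * (1 / 6 * tw + 1 / 6 * tx + 1 / 3 * tuv + 1 / 6 * tvu + 1 ^+ 3 / 6 * tuuu) =
  f0 + h * tu + h ^+ 2 / 2 * (tv + tuu) + h ^+ 3 / 6 * (tx + tw + 2 * tuv + tvu + tuuu).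
Proof. by field. Qed.

Lemma taylor_sum3 (R : realType) (T : nat -> R) (h : R) :
  \sum_(i < 3) T i / i`!%:R * h ^+ i = T 0%N + h * T 1%N + h ^+ 2 / 2 * T 2%N.
Proof. by rewrite !big_ord_recl big_ord0 /= /bump /= !(factS, fact0); field. Qed.

Lemma taylor_sum4 (R : realType) (T : nat -> R) (h : R) :
  \sum_(i < 4) T i / i`!%:R * h ^+ i =
  T 0%N + h * T 1%N + h ^+ 2 / 2 * T 2%N + h ^+ 3 / 6 * T 3%N.
Proof. by rewrite !big_ord_recl big_ord0 /= /bump /= !(factS, fact0); field. Qed.

Section Sufficiency.
Context {R : realType} (P : problem R).
Local Notation V := 'rV[R]_(gdim P).
Local Notation M := (mfd P).
Implicit Types (F : M -> R) (u v w x : V) (p : M).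

Lemma bigO_of_eqO k (f g : R -> R) :
  eqO k (f : R -> R^o) g -> (fun h : R => f h - g h) =O_ (0 : R) (fun h : R => h ^+ k).
Proof.
move=> [K H]; apply/eqOP; near=> k'; near=> h.
rewrite normrX; apply: (le_trans (y := K * `|h| ^+ k)); first by near: h.
by rewrite ler_wpM2r ?exprn_ge0.
Unshelve. all: by end_near. Qed.

Lemma eqO_sym (W : normedModType R) k (f g : R -> W) : eqO k f g -> eqO k g f.
Proof.
by apply: bO_near; near=> h; rewrite -normrN opprB.
Unshelve. all: by end_near. Qed.

Lemma gfun_one_step p (A : R -> V) (al nu : R) u v :
  eqO 2 A (fun h => al *: u + (h * nu) *: v) ->
  eqO 3 (fun h => gfun P (exp_act (h *: A h) p))
    (fun h => gfun P p + (h * al) *: gvec [:: u] p +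
      ((h ^+ 2 * (al ^+ 2 / 2)) *: gvec [:: u; u] p + (h ^+ 2 * nu) *: gvec [:: v] p)).
Proof.
move=> eA; apply: eqO_rV => i.
apply: eqO_trans (one_step_exp p (@gfun_smooth R P i) eA) _.
by apply: eqO_eq => h; rewrite !mxE; ring.
Qed.

Lemma gfun_two_step p (A B : R -> V) (al be : R) u :
  eqO 1 A (fun=> al *: u) -> eqO 1 B (fun=> be *: u) ->
  eqO 2 (fun h => gfun P (exp_act (h *: B h) (exp_act (h *: A h) p)))
    (fun h => gfun P p + (h * (al + be)) *: gvec [:: u] p).
Proof.
move=> eA eB; apply: eqO_rV => i.
apply: eqO_trans (two_step_exp2 p (@gfun_smooth R P i) eA eB) _.
by apply: eqO_eq => h; rewrite !mxE; ring.
Qed.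

Lemma sol_eqO k F p (y : R -> M) : psmooth F -> is_solution p y ->
  eqO k (fun h => F (y h) : R^o)
    (fun h => \sum_(i < k) iter i (@flow_der R P) F p / i`!%:R * h ^+ i : R^o).
Proof. by move=> sF sol; have [K _ H] := sol_taylor k sF sol; exists K. Qed.

Lemma solution_exp3 F p (y : R -> M) : psmooth F -> is_solution p y ->
  let u := gfun P p in let v := gvec [:: u] p in
  eqO 3 (fun h => F (y h) : R^o)
    (fun h => F p + h * pderw [:: u] F p +
      h ^+ 2 / 2 * (pderw [:: v] F p + pderw [:: u; u] F p) : R^o).
Proof.
move=> sF sol u v; refine (eqO_trans (sol_eqO 3 sF sol) _).
apply: eqO_eq => h; rewrite (taylor_sum3 (fun i => iter i (@flow_der R P) F p)) /=.
by rewrite (flow_der_iter2 p sF).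
Qed.

Lemma solution_exp4 F p (y : R -> M) : psmooth F -> is_solution p y ->
  let u := gfun P p in let v := gvec [:: u] p in
  eqO 4 (fun h => F (y h) : R^o)
    (fun h => F p + h * pderw [:: u] F p +
      h ^+ 2 / 2 * (pderw [:: v] F p + pderw [:: u; u] F p) +
      h ^+ 3 / 6 * (pderw [:: gvec [:: v] p] F p + pderw [:: gvec [:: u; u] p] F p +
         2 * pderw [:: u; v] F p + pderw [:: v; u] F p + pderw [:: u; u; u] F p) : R^o).
Proof.
move=> sF sol u v; refine (eqO_trans (sol_eqO 4 sF sol) _).
apply: eqO_eq => h; rewrite (taylor_sum4 (fun i => iter i (@flow_der R P) F p)) /=.
by rewrite (flow_der_iter3 p sF) (flow_der_iter2 p sF).
Qed.

Context (a a31 a32 b1 b2 b3 : R) (p : M).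
Let c3 := a31 + a32.
Let u := gfun P p.
Let v := gvec [:: u] p.
Let w := gvec [:: u; u] p.
Let x := gvec [:: v] p.

(** The stages as functions of [h] alone, with the trivial action of [cf_g1] already simplified, in
    the form required by the expansions. *)
Definition stage2 (h : R) : V := gfun P (exp_act (h *: (a *: u)) p).
Definition stage3_arg (h : R) : V := a31 *: u + a32 *: stage2 h.
Definition stage3 (h : R) : V := gfun P (exp_act (h *: stage3_arg h) p).
Definition update_arg (h : R) : V := b1 *: u + b2 *: stage2 h + b3 *: stage3 h.

Lemma cf_f1E : cf_f1 p = u.
Proof. by rewrite /cf_f1 /cf_g1; have [-> _ _] := actP P. Qed.

Lemma cf_f2E h : cf_f2 a h p = stage2 h.
Proof. by rewrite /cf_f2 /cf_g2 cf_f1E. Qed.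

Lemma cf_f3E h : cf_f3 a a31 a32 h p = stage3 h.
Proof. by rewrite /cf_f3 /cf_g3 cf_f1E cf_f2E. Qed.

Lemma cf_stepE h : cf_step a a31 a32 b1 b2 b3 h p =
  exp_act (h *: update_arg h) (exp_act (h *: stage3_arg h) p).
Proof.
rewrite /cf_step cf_f1E cf_f2E cf_f3E /cf_g3 cf_f1E cf_f2E.
by have [_ -> _] := actP P.
Qed.

Lemma stage2_exp : eqO 3 stage2 (fun h => u + (h * a) *: v + (h ^+ 2 * (a ^+ 2 / 2)) *: w).
Proof.
(* The argument of the second exponential does not depend on [h]: zero slope, with a dummy
   vector. *)
have eA : eqO 2 (fun=> a *: u) (fun h => a *: u + (h * 0) *: (0 : V)).
  by apply: eqO_eq => h; rewrite scaler0 addr0.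
apply: eqO_trans (gfun_one_step p eA) _.
by apply: eqO_eq => h; rewrite mulr0 scale0r addr0.
Qed.

Lemma stage3_arg_exp : eqO 3 stage3_arg
  (fun h => c3 *: u + (h * (a32 * a)) *: v + (h ^+ 2 * (a32 * a ^+ 2 / 2)) *: w).
Proof.
apply: eqO_trans (eqO_D (eqO_refl _ _) (eqO_Z a32 stage2_exp)) _.
by apply: eqO_eq => h; apply/rowP => i; rewrite /c3 !mxE; ring.
Qed.

Lemma stage3_arg_exp2 : eqO 2 stage3_arg (fun h => c3 *: u + (h * (a32 * a)) *: v).
Proof. exact: eqO_trans (eqO_le (leqnSn 2) stage3_arg_exp) (eqO_addO _ (bO_hXc 2 _ _)). Qed.

(** The [x] component appears here for the first time: it comes from the [v] component of the
    argument, that is, from the nesting of the second stage in the third. *)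
Lemma stage3_exp : eqO 3 stage3 (fun h => u + (h * c3) *: v +
  ((h ^+ 2 * (c3 ^+ 2 / 2)) *: w + (h ^+ 2 * (a32 * a)) *: x)).
Proof. exact: gfun_one_step stage3_arg_exp2. Qed.

Lemma update_arg_exp : eqO 3 update_arg
  (fun h => (b1 + b2 + b3) *: u + (h * (b2 * a + b3 * c3)) *: v +
    ((h ^+ 2 * ((b2 * a ^+ 2 + b3 * c3 ^+ 2) / 2)) *: w
      + (h ^+ 2 * (b3 * (a32 * a))) *: x)).
Proof.
apply: eqO_trans (eqO_D (eqO_D (eqO_refl _ _) (eqO_Z b2 stage2_exp))
  (eqO_Z b3 stage3_exp)) _.
by apply: eqO_eq => h; apply/rowP => i; rewrite !mxE;
  move: (u 0 i) (v 0 i) (w 0 i) (x 0 i) => ui vi wi xi; field.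
Qed.

End Sufficiency.

(** * From the equations on the coefficients to the orders of the schemes *)

Section OrderConditions.
Context {R : realType} (a a31 a32 b1 b2 b3 : R).
Let c3 := a31 + a32.
Hypotheses (oc1 : c3 + (b1 + b2 + b3) = 1)
  (oc2 : a32 * a + (b2 * a + b3 * c3) = 1 / 2)
  (oc3w : a32 * a ^+ 2 / 2 + (b2 * a ^+ 2 + b3 * c3 ^+ 2) / 2 = 1 / 6)
  (oc3x : b3 * (a32 * a) = 1 / 6)
  (oc3uv : c3 * (a32 * a) / 2 + c3 * (b2 * a + b3 * c3)
    + (b1 + b2 + b3) * (b2 * a + b3 * c3) / 2 = 1 / 3)
  (oc3vu : c3 * (a32 * a) / 2 + a32 * a * (b1 + b2 + b3)
    + (b1 + b2 + b3) * (b2 * a + b3 * c3) / 2 = 1 / 6).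

Lemma cf_scheme_order3 : has_order 3 (cf_scheme a a31 a32 b1 b2 b3).
Proof.
move=> P p y psi sol spsi; apply: (@bigO_of_eqO _ 4 (fun h => psi (y h))
  (fun h => psi (cf_scheme a a31 a32 b1 b2 b3 h p))).
apply: eqO_trans (solution_exp4 spsi sol) (eqO_sym _).
rewrite (_ : (fun h : R => psi _) = (fun h => psi
  (exp_act (h *: update_arg a a31 a32 b1 b2 b3 p h)
  (exp_act (h *: stage3_arg a a31 a32 p h) p)))); last first.
  by apply/funext => h; rewrite /cf_scheme cf_stepE.
apply: eqO_trans (two_step_exp4 p spsi (stage3_arg_exp _ _ _ _)
  (update_arg_exp _ _ _ _ _ _ _)) _.
rewrite oc1 oc2 oc3w oc3x oc3uv oc3vu; apply: eqO_eq => h; exact: order3_identity.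
Qed.

Hypotheses (e1 e2 e3 e4 : R) (em1 : e1 + e2 + e3 + e4 = 1)
  (em2 : a * e2 + c3 * e3 + e4 = 1 / 2).

(** By [oc1] the update is consistent, so [f_4] is [u + h v] up to O(h^2), as for a stage with node
    1. Then [em1] and [em2] make the argument of the single exponential [u + (h/2) v], which matches
    the exact flow to second order. *)
Lemma cf_embedded_scheme_order2 : has_order 2 (cf_embedded_scheme a a31 a32 b1 b2 b3 e1
  e2 e3 e4).
Proof.
move=> P p y psi sol spsi; apply: (@bigO_of_eqO _ 3 (fun h => psi (y h))
  (fun h => psi (cf_embedded_scheme a a31 a32 b1 b2 b3 e1 e2 e3 e4 h p))).
apply: eqO_trans (solution_exp3 spsi sol) (eqO_sym _).
set u := gfun P p; set v := gvec [:: u] p.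
pose A := stage3_arg a a31 a32 p; pose B := update_arg a a31 a32 b1 b2 b3 p.
have eA : eqO 1 A (fun=> c3 *: u) := eqO_lin0 (stage3_arg_exp2 _ _ _ _).
have eB : eqO 1 B (fun=> (b1 + b2 + b3) *: u).
  have eB3 := update_arg_exp a a31 a32 b1 b2 b3 p.
  apply: eqO_lin0 (eqO_trans (eqO_le (leqnSn 2) eB3)
    (eqO_addO _ (bO_D (bO_hXc 2 _ _) (bO_hXc 2 _ _)))).
pose f4 h := gfun P (exp_act (h *: B h) (exp_act (h *: A h) p)).
have ef4 : eqO 2 f4 (fun h => u + (h * 1) *: v) by rewrite -oc1; exact: gfun_two_step eA eB.
have ef2 : eqO 2 (stage2 a p) (fun h => u + (h * a) *: v).
  exact: eqO_trans (eqO_le (leqnSn 2) (stage2_exp _ _)) (eqO_addO _ (bO_hXc 2 _ _)).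
have ef3 : eqO 2 (stage3 a a31 a32 p) (fun h => u + (h * c3) *: v).
  exact: eqO_trans (eqO_le (leqnSn 2) (stage3_exp _ _ _ _))
    (eqO_addO _ (bO_D (bO_hXc 2 _ _) (bO_hXc 2 _ _))).
pose C h := e1 *: u + e2 *: stage2 a p h + e3 *: stage3 a a31 a32 p h + e4 *: f4 h.
have eC : eqO 2 C (fun h => 1 *: u + (h * (1 / 2)) *: v).
  apply: eqO_trans (eqO_D (eqO_D (eqO_D (eqO_refl _ _) (eqO_Z e2 ef2)) (eqO_Z e3 ef3))
    (eqO_Z e4 ef4)) _.
  by apply: eqO_eq => h; apply/rowP => i; rewrite -em2 (_ : e1 = 1 - e2 - e3 - e4) ?mxE;
    [ring|rewrite -em1; ring].
rewrite (_ : (fun h : R => psi _) = (fun h => psi (exp_act (h *: C h) p))); last first.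
  apply/funext => h; rewrite /cf_embedded_scheme /cf_embedded_step cf_f1E cf_f2E cf_f3E.
  by rewrite /cf_f4 cf_stepE.
apply: eqO_trans (one_step_exp p spsi eC) _.
apply: eqO_eq => h; exact: order2_identity.
Qed.

End OrderConditions.

(** * The Heisenberg group as a test problem *)

Section EuclideanManifold.
Context {R : realType} (n : nat).

(** Balls with rational centre and radius form a base. Around [x], a radius [r] between e/4 and e/2
    and a centre within r/2 of [x] give a ball that contains [x] and stays within 3r/2 < e of it. *)
Lemma rV_second_countable : @second_countable 'rV[R]_n.
Proof.
pose B (cr : 'rV[rat]_n * rat) : set 'rV[R]_n :=
  ball (\row_i ratr (cr.1 0 i) : 'rV[R]_n) (ratr cr.2).
exists (range B).
  by apply: sub_countable (countableP [set: 'rV[rat]_n * rat]); exact: card_image_le.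
split=> [_ [cr _ <-]|x U /nbhs_ballP[e /= e0 xU]]; first exact: ball_open.
have e4 : e / 4 < e / 2 by lra.
have [r] := rat_in_itvoo e4; rewrite in_itv /= => /andP[r1 r2].
have r0 : 0 < ratr r :> R by apply: lt_trans r1; lra.
have cx i : exists q : rat, `|ratr q - x 0 i| <= ratr r / 2.
  have xr : x 0 i - ratr r / 2 < x 0 i + ratr r / 2 by lra.
  have [q] := rat_in_itvoo xr; rewrite in_itv /= => /andP[q1 q2].
  by exists q; rewrite ler_distl; apply/andP; split; lra.
pose c : 'rV[rat]_n := \row_i sval (cid (cx i)).
have nc : `|(\row_i ratr (c 0 i) : 'rV[R]_n) - x| <= ratr r / 2.
  apply: rV_norm_le => [|i]; first by lra.
  by rewrite !mxE; exact: (svalP (cid (cx i))).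
exists (B (c, r)).
  split; first by exists (c, r).
  by rewrite /B -ball_normE /= (le_lt_trans nc) //; lra.
move=> z /=; rewrite /B -ball_normE /= => zr; apply: xU; rewrite -ball_normE /=.
rewrite -(subrK (\row_i ratr (c 0 i)) x) -addrA.
apply: (le_lt_trans (ler_normD _ _)); rewrite distrC in nc; lra.
Qed.

Definition id_chart : chart R n 'rV[R]_n := Chart setT id id.
Definition id_atlas : atlas R n 'rV[R]_n := [set id_chart].

End EuclideanManifold.

Definition heis (R : realType) : Type := 'rV[R]_3.
HB.instance Definition _ (R : realType) := Topological.copy (heis R) 'rV[R]_3.

Section HeisenbergGroup.
Context {R : realType}.
Local Notation V := 'rV[R]_3.
Local Notation H := (heis R).

Definition i0 : 'I_3 := @Ordinal 3 0 isT.
Definition i1 : 'I_3 := @Ordinal 3 1 isT.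
Definition i2 : 'I_3 := @Ordinal 3 2 isT.

Definition vec3 (a b c : R) : V := \row_i nth 0 [:: a; b; c] i.

Lemma row3P (x y : V) : x 0 i0 = y 0 i0 -> x 0 i1 = y 0 i1 -> x 0 i2 = y 0 i2 -> x = y.
Proof.
move=> e0 e1 e2; apply/rowP => -[[|[|[|//]]] Hi].
- by rewrite (_ : Ordinal Hi = i0) //; exact: val_inj.
- by rewrite (_ : Ordinal Hi = i1) //; exact: val_inj.
- by rewrite (_ : Ordinal Hi = i2) //; exact: val_inj.
Qed.

(** Half of the Heisenberg bracket, whose only component is the central one, with index [i2]. *)
Definition area (x y : V) : R := (x 0 i0 * y 0 i1 - x 0 i1 * y 0 i0) / 2.

(* Exponential coordinates: by the Baker-Campbell-Hausdorff formula the product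
   is [x + y + [x, y] / 2], so that the exponential map is the identity. *)
Definition hmul (x y : H) : H := (x : V) + y + area x y *: delta_mx 0 i2.
Definition hone : H := 0 : V.
Definition hinv (x : H) : H := - (x : V).

Lemma hmul0 (x y : V) : hmul x y 0 i0 = x 0 i0 + y 0 i0.
Proof. by rewrite /hmul !mxE /= mulr0 addr0. Qed.
Lemma hmul1 (x y : V) : hmul x y 0 i1 = x 0 i1 + y 0 i1.
Proof. by rewrite /hmul !mxE /= mulr0 addr0. Qed.
Lemma hmul2 (x y : V) : hmul x y 0 i2 = x 0 i2 + y 0 i2 + area x y.
Proof. by rewrite /hmul !mxE /= mulr1. Qed.

Lemma hmulA : associative hmul.
Proof.
by move=> x y z; apply: row3P; rewrite ?(hmul0, hmul1, hmul2) /area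
  ?(hmul0, hmul1, hmul2); field.
Qed.
Lemma hmul1g : left_id hone hmul.
Proof. by move=> x; apply: row3P; rewrite ?(hmul0, hmul1, hmul2) /area !mxE; field. Qed.
Lemma hmulg1 : right_id hone hmul.
Proof. by move=> x; apply: row3P; rewrite ?(hmul0, hmul1, hmul2) /area !mxE; field. Qed.
Lemma hmulVg : left_inverse hone hinv hmul.
Proof. by move=> x; apply: row3P; rewrite ?(hmul0, hmul1, hmul2) /area !mxE; field. Qed.
Lemma hmulgV : right_inverse hone hinv hmul.
Proof. by move=> x; apply: row3P; rewrite ?(hmul0, hmul1, hmul2) /area !mxE; field. Qed.

HB.instance Definition _ := isGroup.Build H hmulA hmul1g hmulg1 hmulVg hmulgV.

Definition heis_atlas : atlas R 3 H := @id_atlas R 3.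

Lemma hausdorff_rV : hausdorff_space 'rV[R]_3.
Proof. exact: norm_hausdorff. Qed.

Lemma smooth_id (n : nat) (U : set 'rV[R]_n) : smooth_on U (id : 'rV[R]_n -> 'rV[R]_n).
Proof. by move=> k; exact: (Ck_on_lin k U (L := idfun : {linear 'rV[R]_n -> 'rV[R]_n})
  (fun x => cvg_id)). Qed.

Lemma heis_manifold : is_manifold heis_atlas.
Proof.
split.
- exact: hausdorff_rV.
- exact: rV_second_countable.
- move=> _ ->; split.
  + exact: openT.
  + by rewrite /= image_id; exact: openT.
  + by [].
  + by move=> x _; exact: cvg_id.
  + by move=> x _; exact: cvg_id.
- by move=> x; exists (@id_chart R 3).
- by move=> _ _ -> ->; exact: smooth_id.
Qed.

Lemma Ck_on_scalel (V' W : normedModType R) k (U : set V') (f : V' -> R) (w : W) :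
  open U -> Ck_on k U f -> Ck_on k U (fun x => f x *: w).
Proof.
move=> oU.
have lin : linear (fun c : R^o => c *: w) by move=> c u v; rewrite scalerDl scalerA.
pose l : {linear R^o -> W} := HB.pack_for {linear R^o -> W} (fun c : R^o => c *: w)
  (GRing.isLinear.Build _ _ _ _ _ lin).
apply: (@Ck_on_comp_lin R V' R^o W k U l) => // x.
by apply: cvgZr_tmp; exact: cvg_id.
Qed.

Lemma Ck_onMl (V' : normedModType R) k (U : set V') (c : R) (f : V' -> R) :
  open U -> Ck_on k U f -> Ck_on k U (fun x => c * f x).
Proof. by move=> oU; apply: (@Ck_onM R V' k U (cst c)) => //; exact: Ck_on_cst. Qed.

Lemma hmul_smooth k : Ck_on k setT (fun v : 'rV[R]_(3 + 3)
  => hmul (lsubmx v) (rsubmx v) : V).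
Proof.
have oT := @openT 'rV[R]_(3 + 3).
pose xl (v : 'rV[R]_(3+3)) : V := lsubmx v; pose yr (v : 'rV[R]_(3+3)) : V := rsubmx v.
have cl : Ck_on k setT xl.
  by apply: (Ck_on_lin k setT (L := lsubmx : {linear 'rV[R]_(3+3) -> V}));
    exact: continuous_linear_rV.
have cr : Ck_on k setT yr.
  by apply: (Ck_on_lin k setT (L := rsubmx : {linear 'rV[R]_(3+3) -> V}));
    exact: continuous_linear_rV.
have cli i : Ck_on k setT (fun v => xl v 0 i : R) by exact: Ck_on_coord.
have cri i : Ck_on k setT (fun v => yr v 0 i : R) by exact: Ck_on_coord.
apply: (Ck_on_congr oT) (Ck_onD oT (Ck_onD oT cl cr) (Ck_on_scalel (delta_mx 0 i2 : V) oT
  (Ck_onD oT (Ck_onMl 2^-1 oT (Ck_onM oT (cli i0) (cri i1)))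
             (Ck_onMl (- 2^-1) oT (Ck_onM oT (cli i1) (cri i0)))))).
move=> v _ /=; rewrite /hmul /area; congr (_ + _ *: _).
by rewrite /xl /yr; field.
Qed.

Lemma hmul_continuous : continuous (fun z : V * V => hmul z.1 z.2 : V).
Proof.
move=> z.
have cf : {for z, continuous (fun z : V * V => row_mx z.1 z.2)}.
  have -> : (fun z : V * V => row_mx z.1 z.2) = (fun z => row_r 3 z.2 + row_l 3 z.1).
    by apply/funext => y; rewrite row_mx_lr.
  apply: cvgD.
    by apply: (@continuous_comp _ _ _ snd (@row_r R 3 3));
      [exact: cvg_snd|exact: continuous_linear_rV].
  by apply: (@continuous_comp _ _ _ fst (@row_l R 3 3));
    [exact: cvg_fst|exact: continuous_linear_rV].
have -> : (fun z : V * V => hmul z.1 z.2 : V) = (fun v => hmul (lsubmx v) (rsubmx v)) \o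
  (fun z => row_mx z.1 z.2).
  by apply/funext => y /=; rewrite row_mxKl row_mxKr.
by apply: continuous_comp => //; exact: (hmul_smooth 0).
Qed.

Lemma heis_mul_smooth : smooth_map (prod_atlas heis_atlas heis_atlas) heis_atlas
  (fun z : H * H => (z.1 * z.2)%g).
Proof.
split; first exact: hmul_continuous.
move=> _ _ [c [d [-> -> ->]]] -> k.
by apply: (@Ck_on_sub _ _ _ _ setT) => //; exact: hmul_smooth.
Qed.

Lemma heis_lie : is_lie_group heis_atlas.
Proof.
split; [exact: heis_manifold|exact: heis_mul_smooth|split].
  exact: (@continuous_linear_rV R 3 V (-%R : {linear V -> V})).
move=> _ _ -> -> k.
apply: (@Ck_on_lin _ _ _ _ _ (-%R : {linear V -> V})) => //; exact: continuous_linear_rV.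
Qed.

Lemma heis_act : is_smooth_action heis_atlas heis_atlas (fun x y : H => (x * y)%g).
Proof.
split; [exact: mul1g|move=> x y q; exact/esym/mulgA|exact: heis_mul_smooth].
Qed.

Lemma is_derive_scalel (W : normedModType R) (f : R -> R) (t df : R) (w : W) :
  is_derive t 1 f df -> is_derive t 1 (fun s => f s *: w) (df *: w).
Proof.
move=> fd; have := is_derive_comp_diff fd (f := fun c : R => c *: w).
have [d1 d2] := is_diff_scalel (f t) w.
by move=> /(_ d1); rewrite d2.
Qed.

(** The area of two multiples of the same vector is zero, so lines through the origin are
    one-parameter subgroups. *)
Lemma heis_exp : is_exp heis_atlas (@id_chart R 3) (id : V -> H).
Proof.
move=> u; have lin : linear (fun t : R^o => t *: u) by move=> c x y;
  rewrite scalerDl scalerA.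
have dt (t : R) : is_derive t (1 : R) (fun t : R => t *: u) u.
  by rewrite -[Y in is_derive _ _ _ Y]scale1r; apply: is_derive_scalel; exact: is_derive_id.
split.
- split.
    by move=> t; apply/differentiable_continuous/derivable1_diffP; have [] := dt t.
  move=> _ -> k.
  apply: (@Ck_on_sub _ _ _ _ setT) => //.
  apply: Ck_on_scalel; first exact: openT.
  exact: (Ck_on_lin k setT (L := idfun : {linear R^o -> R^o}) (fun x => cvg_id)).
- by move=> s t; apply: row3P; rewrite ?(hmul0, hmul1, hmul2) /area !mxE; field.
- exact: dt.
Qed.

Section TestProblem.
Context (al de ga : R).

(* Along a solution starting at the origin the first coordinate is the time; the
   second one detects the classical conditions of order 2 ([al]) and 3 ([de]),
   and the third one the noncommutative condition ([al]) and, together with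
   [ga], the condition coming from nested stages. *)
Definition test_field (q : H) : V :=
  vec3 1 (al * (q : V) 0 i0 + de * (q : V) 0 i0 ^+ 2) (ga * (q : V) 0 i1).

Lemma vec3E a b c : vec3 a b c = a *: delta_mx 0 i0 + b *: delta_mx 0 i1
  + c *: delta_mx 0 i2.
Proof. by apply: row3P; rewrite !mxE /= !(mulr1, mulr0, addr0, add0r). Qed.

Lemma test_field_smooth : smooth_fun heis_atlas test_field.
Proof.
move=> _ -> k; rewrite /= image_id.
have oT := @openT V.
have ci i : Ck_on k setT (fun q : V => q 0 i : R).
  by apply: Ck_on_coord => //; exact: smooth_id.
apply: (Ck_on_congr oT) (Ck_onD oT (Ck_onD oT (Ck_on_cst k setT (delta_mx 0 i0 : V))
   (Ck_on_scalel (delta_mx 0 i1 : V) oT (Ck_onD oT (Ck_onMl al oT (ci i0))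
     (Ck_onMl de oT (Ck_onM oT (ci i0) (ci i0))))))
   (Ck_on_scalel (delta_mx 0 i2 : V) oT (Ck_onMl ga oT (ci i1)))).
by move=> v _; rewrite /= /test_field vec3E scale1r expr2.
Qed.

Definition test_problem : problem R :=
  @Problem R 3 H heis_atlas (@id_chart R 3) id 3 H heis_atlas (fun x y : H => (x * y)%g)
    test_field heis_lie erefl I heis_exp heis_manifold heis_act test_field_smooth.

End TestProblem.

End HeisenbergGroup.

(** * Necessity of the order conditions *)

Section Necessity.
Context {R : realType}.
Local Notation V := 'rV[R]_3.

(** On the test problem, a suitable choice of parameters and coordinate makes the error a single
    monomial in [h]. Its coefficient is the defect of one order condition. *)
Lemma bigO_monomial_eq0 (f : R -> R) (c : R) k n : (k < n)%N ->
  f =O_ (0 : R) (fun h : R => h ^+ n) -> (forall h, f h = c * h ^+ k) -> c = 0.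
Proof.
move=> kn + /funext fE; rewrite fE => /eqO_exP[K K0 nK]; apply/eqP;
  rewrite -normr_eq0 -[_ == 0]negbK; apply/negP => c0.
have {}c0 : 0 < `|c| by rewrite lt_def c0 /=.
(* Below 1 the factor h^(n-k) is at most h; below |c| / K the monomial then exceeds its bound. *)
have : \forall h \near (0 : R), `|h| < Num.min 1 (`|c| / K).
  by apply: near0_lt; rewrite lt_min ltr01 divr_gt0.
move=> nh; have [r /= r0 Hr] := (nbhs_ballP _ _).1 (filterI nK nh).
have r2 : 0 < r / 2 by lra.
have [] := Hr (r / 2); first by rewrite /ball /= sub0r normrN gtr0_norm //; lra.
rewrite /= lt_min !(gtr0_norm r2) => H /andP[r1 rc].
move: H; rewrite normrM !normrX !(gtr0_norm r2) leNgt => /negP; apply.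
rewrite -(subnKC kn) addSnnS exprD mulrCA [Y in _ < Y]mulrC ltr_pM2l ?exprn_gt0 //.
rewrite ltr_pdivlMr // mulrC in rc; apply: le_lt_trans rc.
rewrite ler_wpM2l ?(ltW K0) // exprS ler_piMr ?(ltW r2) // exprn_ile1 ?(ltW r2)
  ?(ltW r1) //.
Qed.

Lemma is_derive_monomial (c t : R) k (W : normedModType R) (w : W) :
  is_derive t 1 (fun s => (c * s ^+ k.+1) *: w) ((c * k.+1%:R * t ^+ k) *: w).
Proof.
apply: is_derive_scalel.
have := is_derive_poly (c *: 'X^(k.+1)) t.
rewrite derivZ derivXn hornerZ hornerMn hornerXn /= -mulr_natl mulrA.
by rewrite (_ : horner _ = (fun s => c * s ^+ k.+1)) //; apply/funext => s;
  rewrite hornerZ hornerXn.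
Qed.

Section Curve.
Context (al de ga : R).
Let P := test_problem al de ga.

(** The exact solution, found by integrating the coordinates one after the other; the third equation
    also receives the area of the field and the point. The sum of monomials times basis vectors is
    the shape that [is_derive_monomial] differentiates. *)
Definition test_curve (t : R) : mfd P :=
  (1 * t ^+ 1) *: delta_mx 0 i0 + (al / 2 * t ^+ 2) *: delta_mx 0 i1 +
  (de / 3 * t ^+ 3) *: delta_mx 0 i1 + ((ga * al / 6 - al / 12) * t ^+ 3) *: delta_mx 0 i2 +
  ((ga * de / 12 - de / 12) * t ^+ 4) *: delta_mx 0 i2 : V.

Lemma test_curveE t : test_curve t = vec3 t (al / 2 * t ^+ 2 + de / 3 * t ^+ 3)
  ((ga * al / 6 - al / 12) * t ^+ 3 + (ga * de / 12 - de / 12) * t ^+ 4).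
Proof.
by rewrite /test_curve; apply: row3P; rewrite !mxE /= !(mulr0, mulr1, mul1r, addr0, add0r).
Qed.

Lemma test_curve_deriv (t : R) : is_derive t (1 : R) (test_curve : R -> V)
  (vec3 1 (al * t + de * t ^+ 2)
   ((ga * al / 6 - al / 12) * 3 * t ^+ 2 + (ga * de / 12 - de / 12) * 4 * t ^+ 3)).
Proof.
apply: (is_derive_eq (is_deriveD (is_deriveD (is_deriveD (is_deriveD
  (is_derive_monomial 1 t 0 _) (is_derive_monomial (al / 2) t 1 _))
  (is_derive_monomial (de / 3) t 2 _)) (is_derive_monomial _ t 2 _))
    (is_derive_monomial _ t 3 _))).
by apply: row3P; rewrite !mxE /= !(mulr0, mulr1, mul1r, addr0, add0r); field.
Qed.

Lemma heis_inf_action (u q : V) : inf_action (P := P) (@id_chart R 3) u q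
  = u + area u q *: delta_mx 0 i2.
Proof.
rewrite /inf_action.
have -> : (fun t : R => @id_chart R 3 (act P (gexp P (t *: u)) q))
  = (fun t : R => q + t *: (u + area u q *: delta_mx 0 i2)).
  by apply/funext => t; apply: row3P; rewrite /= ?(hmul0, hmul1, hmul2) /area !mxE /=;
    field.
have D : is_derive (0 : R) (1 : R) (fun t : R => t
  *: (u + area u q *: delta_mx 0 i2 : V)) (1 *: (u + area u q *: delta_mx 0 i2 : V)).
  by apply: is_derive_scalel; exact: is_derive_id.
have [_ D2] := is_deriveD (is_derive_cst q (0 : R) (1 : R)) D.
by apply: (etrans D2); rewrite add0r scale1r.
Qed.

Lemma test_curve_solution : is_solution (P := P) (1%g : heis R) test_curve.
Proof.
split.
  by rewrite test_curveE; apply: row3P; rewrite !mxE /= ?expr0n /= ?mulr0 ?addr0.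
near=> t; split.
  by apply/differentiable_continuous/derivable1_diffP; have [] := test_curve_deriv t.
move=> _ -> _; rewrite heis_inf_action.
apply: is_derive_eq (test_curve_deriv t) _.
by rewrite test_curveE /=; apply: row3P; rewrite /area !mxE /=; field.
Unshelve. all: by end_near. Qed.

Context (a a31 a32 b1 b2 b3 : R).
Let c3 := a31 + a32.
(** [F2] and [F3] are the second components of [f_2] and [f_3]: from the origin, the stages have
    first coordinates [h * a] and [h * c3]. *)
Let F2 h := al * (h * a) + de * (h * a) ^+ 2.
Let F3 h := al * (h * c3) + de * (h * c3) ^+ 2.

Lemma test_step h : @cf_scheme R a a31 a32 b1 b2 b3 P h (1%g : heis R) =
  vec3 (h * (c3 + (b1 + b2 + b3))) (h * (a32 * F2 h + b2 * F2 h + b3 * F3 h))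
    (h * (b3 * (ga * (h * a32 * F2 h))) +
     h ^+ 2 * ((b1 + b2 + b3) * (a32 * F2 h) - c3 * (b2 * F2 h + b3 * F3 h)) / 2).
Proof.
have f1 : cf_f1 (P := P) (1%g : heis R) = vec3 1 0 0.
  by rewrite /cf_f1 /cf_g1 /= mul1g /test_field; congr vec3; rewrite !mxE; ring.
have f2 : cf_f2 (P := P) a h (1%g : heis R) = vec3 1 (F2 h) 0.
  by rewrite /cf_f2 /cf_g2 f1 /= mulg1 /test_field; congr vec3; rewrite !mxE /= /F2; ring.
have g3 : cf_g3 (P := P) a a31 a32 h (1%g : heis R) = vec3 (h * c3) (h * a32 * F2 h) 0.
  by rewrite /cf_g3 f1 f2 /=; apply: row3P; rewrite !mxE /= /c3; ring.
have f3 : cf_f3 (P := P) a a31 a32 h (1%g : heis R) = vec3 1 (F3 h) (ga * (h * a32 * F2 h)).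
  by rewrite /cf_f3 g3 /= mulg1 /test_field; congr vec3; rewrite !mxE /= /F3; ring.
by rewrite /cf_scheme /cf_step f1 f2 f3 g3 /= mulg1; apply: row3P;
  rewrite ?(hmul0, hmul1, hmul2) /area !mxE /=; field.
Qed.

Lemma coord_smooth i : smooth_fun (matlas P) (fun q : heis R => (q : V) 0 i : R).
Proof.
move=> _ -> k; rewrite /= image_id.
by apply: Ck_on_coord; [exact: openT|exact: smooth_id].
Qed.

Lemma test_coord_bigO i : has_order 3 (cf_scheme a a31 a32 b1 b2 b3) ->
  (fun h : R => (test_curve h : V) 0 i - (@cf_scheme R a a31 a32 b1 b2 b3 P h
    (1%g : heis R) : V) 0 i)
   =O_ (0 : R) (fun h : R => h ^+ 4).
Proof. move=> H; exact: (H P _ _ _ test_curve_solution (coord_smooth i)). Qed.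

End Curve.

(** Each equation is read off one coordinate of the test problem. The last one is the difference of
    the conditions at [X_v X_u] and [X_u X_v]; their sum is [(c3 + be) * (nu + m)], fixed by the
    first two equations. *)
Lemma order3_conditions (a a31 a32 b1 b2 b3 : R) :
  has_order 3 (cf_scheme a a31 a32 b1 b2 b3) ->
  let c3 := a31 + a32 in let be := b1 + b2 + b3 in
  let nu := a32 * a in let m := b2 * a + b3 * c3 in
  [/\ c3 + be = 1, nu + m = 1 / 2, nu * a + b2 * a ^+ 2 + b3 * c3 ^+ 2 = 1 / 3,
      b3 * nu = 1 / 6 & be * nu - c3 * m = - (1 / 6)].
Proof.
move=> ord c3 be nu m.
have O al de ga i := test_coord_bigO al de ga i ord.
have E1 : c3 + be = 1.
  apply/esym/subr0_eq; apply: (@bigO_monomial_eq0 _ _ 1 4 isT (O 1 0 0 i0)) => h.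
  by rewrite test_curveE test_step !mxE /= -/c3; rewrite /be; ring.
have E2 : nu + m = 1 / 2.
  apply/esym/subr0_eq; apply: (@bigO_monomial_eq0 _ _ 2 4 isT (O 1 0 0 i1)) => h.
  by rewrite test_curveE test_step !mxE /= -/c3; rewrite /nu /m; field.
have E3 : nu * a + b2 * a ^+ 2 + b3 * c3 ^+ 2 = 1 / 3.
  apply/esym/subr0_eq; apply: (@bigO_monomial_eq0 _ _ 3 4 isT (O 0 1 0 i1)) => h.
  by rewrite test_curveE test_step !mxE /= -/c3; rewrite /nu; field.
have E5 : be * nu - c3 * m = - (1 / 6).
  apply/esym/subr0_eq; apply: (mulIf (x := 2^-1)); first by rewrite invr_eq0 pnatr_eq0.
  rewrite mul0r; apply: (@bigO_monomial_eq0 _ _ 3 4 isT (O 1 0 0 i2)) => h.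
  by rewrite test_curveE test_step !mxE /= -/c3; rewrite /be /nu /m; field.
split=> //.
apply/esym/subr0_eq; apply: (@bigO_monomial_eq0 _ _ 3 4 isT (O 1 0 1 i2)) => h.
(* With [ga = 1] the third coordinate mixes [b3 * nu] with the area term. By [E5] the constants 1/6
   and 1/12 are both expressed through the area term, which then cancels identically. *)
have E6 : 1 / 6 = - (be * nu - c3 * m) by rewrite E5 opprK.
rewrite E6 test_curveE test_step !mxE /= -/c3.
have : (1 * 1 / 6 - 1 / 12) = - (be * nu - c3 * m) / 2 by rewrite E5; field.
by move=> ->; rewrite /be /nu /m; field.
Qed.

End Necessity.

(** * Solving the order conditions *)

Section FamilyCoefficients.
Context {R : realType} (a nu : R) (a0 : a != 0) (a3 : 3 * a - 1 != 0).
Let a31 := (6 * a * nu - 3 * nu + a) / (3 * a).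
Let a32 := nu / a.
Let b1 := (- 12 * a * nu - 6 * nu + a + 1) / (6 * a).
Let b2 := (- 18 * a * nu - 6 * nu + 1) / (6 * a * (3 * a - 1)).
Let b3 := (12 * nu + 3 * a - 2) / (2 * (3 * a - 1)).

Lemma family_c3 : a31 + a32 = (6 * nu + 1) / 3.
Proof. by rewrite /a31 /a32; field. Qed.

Lemma family_b : b1 + b2 + b3 = 2 / 3 - 2 * nu.
Proof. by rewrite /b1 /b2 /b3; field; rewrite a0 a3. Qed.

Hypothesis quad : 36 * nu ^+ 2 + (9 * a - 6) * nu - 3 * a + 1 = 0.

(** Equality modulo the quadratic relation. The explicit [k] in the applications is the quotient of
    [x - y] by the quadratic polynomial in [nu], after which only a field identity remains. *)
Lemma eq_mod_quad (k x y : R) :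
  x - y = k * (36 * nu ^+ 2 + (9 * a - 6) * nu - 3 * a + 1) -> x = y.
Proof. by rewrite quad mulr0 => /subr0_eq. Qed.

Lemma family_m : b2 * a + b3 * ((6 * nu + 1) / 3) = 1 / 2 - nu.
Proof.
apply: (@eq_mod_quad (1 / (3 * (3 * a - 1)))).
by rewrite /b2 /b3; field; rewrite a0 a3.
Qed.

Lemma family_b3 : b3 * (a32 * a) = 1 / 6.
Proof.
apply: (@eq_mod_quad (1 / (6 * (3 * a - 1)))).
by rewrite /b3 /a32; field; rewrite a0 a3.
Qed.

Lemma family_b2 : a32 * a ^+ 2 / 2 + (b2 * a ^+ 2 + b3 * ((6 * nu + 1) / 3) ^+ 2) / 2
  = 1 / 6.
Proof.
apply: (@eq_mod_quad ((3 * nu + 1) / (9 * (3 * a - 1)))).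
by rewrite /a32 /b2 /b3; field; rewrite a0 a3.
Qed.

(** All conditions are expressed in [nu], with c3 = 2 nu + 1/3, b1 + b2 + b3 = 2/3 - 2 nu and b2 a +
    b3 c3 = 1/2 - nu. After this substitution the two noncommutative conditions are identities in
    [nu]. *)
Lemma family_order :
  has_order 3 (cf_scheme a a31 a32 b1 b2 b3) /\
  forall e1 e2 e3 e4, e1 + e2 + e3 + e4 = 1 -> a * e2 + (a31 + a32) * e3 + e4 = 1 / 2 ->
    has_order 2 (cf_embedded_scheme a a31 a32 b1 b2 b3 e1 e2 e3 e4).
Proof.
have a32a : a32 * a = nu by rewrite /a32 divfK.
have oc1 : a31 + a32 + (b1 + b2 + b3) = 1 by rewrite family_c3 family_b; field.
have oc2 : a32 * a + (b2 * a + b3 * (a31 + a32)) = 1 / 2.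
  by rewrite family_c3 family_m a32a; ring.
have oc3w : a32 * a ^+ 2 / 2 + (b2 * a ^+ 2 + b3 * (a31 + a32) ^+ 2) / 2 = 1 / 6.
  by rewrite family_c3 family_b2.
have oc3uv : (a31 + a32) * (a32 * a) / 2 + (a31 + a32) * (b2 * a + b3 * (a31 + a32)) +
    (b1 + b2 + b3) * (b2 * a + b3 * (a31 + a32)) / 2 = 1 / 3.
  by rewrite family_c3 family_m a32a family_b; field.
have oc3vu : (a31 + a32) * (a32 * a) / 2 + a32 * a * (b1 + b2 + b3) +
    (b1 + b2 + b3) * (b2 * a + b3 * (a31 + a32)) / 2 = 1 / 6.
  by rewrite family_c3 family_m a32a family_b; field.
split; first exact: cf_scheme_order3 oc1 oc2 oc3w family_b3 oc3uv oc3vu.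
move=> e1 e2 e3 e4 s1 s2; exact: cf_embedded_scheme_order2 s1 s2.
Qed.

End FamilyCoefficients.

(** Elimination in favour of [nu]: the first two equations and the fifth determine [c3]; then [b2]
    is removed from the third and [b3] by means of the fourth, which leaves the quadratic. The
    remaining coefficients follow by back substitution. *)
Lemma family_of_conditions (R : realType) (a a31 a32 b1 b2 b3 : R) :
  a != 0 -> 3 * a - 1 != 0 ->
  a31 + a32 + (b1 + b2 + b3) = 1 ->
  a32 * a + (b2 * a + b3 * (a31 + a32)) = 1 / 2 ->
  a32 * a * a + b2 * a ^+ 2 + b3 * (a31 + a32) ^+ 2 = 1 / 3 ->
  b3 * (a32 * a) = 1 / 6 ->
  (b1 + b2 + b3) * (a32 * a) - (a31 + a32) * (b2 * a + b3 * (a31 + a32)) = - (1 / 6) ->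
  let nu := a32 * a in
  [/\ 36 * nu ^+ 2 + (9 * a - 6) * nu - 3 * a + 1 = 0,
      a31 = (6 * a * nu - 3 * nu + a) / (3 * a),
      b1 = (- 12 * a * nu - 6 * nu + a + 1) / (6 * a),
      b2 = (- 18 * a * nu - 6 * nu + 1) / (6 * a * (3 * a - 1)) &
      b3 = (12 * nu + 3 * a - 2) / (2 * (3 * a - 1))].
Proof.
move=> a0 a3 e1 e2 e3 e4 e5 nu.
set c3 := a31 + a32 in e1 e2 e3 e5.
have Em : b2 * a + b3 * c3 = 1 / 2 - nu by rewrite -e2 /nu; ring.
have Eb : b1 + b2 + b3 = 1 - c3 by rewrite -e1; ring.
have Ec : c3 = 2 * nu + 1 / 3.
  move: e5; rewrite Em Eb -/nu => e5.
  (* The products [c3 * nu] cancel, so the noncommutative condition becomes linear in [c3]. *)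
  have : (1 - c3) * nu - c3 * (1 / 2 - nu) = nu - c3 / 2 by field.
  by rewrite e5; lra.
have Ea31 : a31 = (6 * a * nu - 3 * nu + a) / (3 * a).
  have -> : a31 = c3 - a32 by rewrite /c3; ring.
  have -> : a32 = nu / a by rewrite /nu mulfK.
  by rewrite Ec; field.
have nu0 : nu != 0.
  by apply/eqP => n0; move: e4; rewrite -/nu n0 mulr0; lra.
have E3 : a / 2 + b3 * c3 * (c3 - a) = 1 / 3.
  rewrite -e3 -/nu.
  have -> : nu * a + b2 * a ^+ 2 + b3 * c3 ^+ 2
    = nu * a + (b2 * a + b3 * c3) * a + b3 * c3 * (c3 - a) by ring.
  by rewrite Em; field.
have q : 36 * nu ^+ 2 + (9 * a - 6) * nu - 3 * a + 1 = 0.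
  (* Multiplying by [nu] makes [b3 * nu] appear, which the fourth equation sets to 1/6. *)
  have : nu * (a / 2 + b3 * c3 * (c3 - a)) = nu * a / 2
    + (b3 * nu) * (c3 * (c3 - a)) by field.
  rewrite E3 [b3 * nu]e4 Ec => /eqP; rewrite -subr_eq0 => /eqP H.
  have -> : 36 * nu ^+ 2 + (9 * a - 6) * nu - 3 * a + 1 =
    - 54 * (nu * (1 / 3) - (nu * a / 2 + 1 / 6
      * ((2 * nu + 1 / 3) * (2 * nu + 1 / 3 - a)))) by field.
  by rewrite H mulr0.
have Eb3 : b3 = (12 * nu + 3 * a - 2) / (2 * (3 * a - 1)).
  (* The fourth equation gives b3 = 1/(6 nu); modulo the quadratic this inverse is affine in
     [nu]. *)
  by apply: (mulIf nu0); rewrite [b3 * nu]e4; apply: (eq_mod_quad q (k :=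
    - 1 / (6 * (3 * a - 1)))); field; rewrite a3.
have Eb2 : b2 = (- 18 * a * nu - 6 * nu + 1) / (6 * a * (3 * a - 1)).
  apply: (mulIf a0); have -> : b2 * a = 1 / 2 - nu - b3 * c3 by rewrite -Em; ring.
  rewrite Eb3 Ec; apply: (eq_mod_quad q (k := - 1 / (3 * (3 * a - 1)))); field;
    by rewrite a0 a3.
split=> //.
have -> : b1 = 1 - c3 - b2 - b3 by rewrite -Eb; ring.
by rewrite Eb2 Eb3 Ec; field; rewrite a0 a3.
Qed.

Theorem mainTheorem3 (R : realType) (a : R) (ha0 : a <> 0) (ha3 : a <> 1 / 3) :
  (forall a31 a32 b1 b2 b3 : R,
     has_order 3 (cf_scheme a a31 a32 b1 b2 b3) <->
     exists nu : R,
       36 * nu ^+ 2 + (9 * a - 6) * nu - 3 * a + 1 = 0 /\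
       a31 = (6 * a * nu - 3 * nu + a) / (3 * a) /\
       a32 = nu / a /\
       b1 = (- 12 * a * nu - 6 * nu + a + 1) / (6 * a) /\
       b2 = (- 18 * a * nu - 6 * nu + 1) / (6 * a * (3 * a - 1)) /\
       b3 = (12 * nu + 3 * a - 2) / (2 * (3 * a - 1))) /\
  (forall nu a31 a32 b1 b2 b3 : R,
     36 * nu ^+ 2 + (9 * a - 6) * nu - 3 * a + 1 = 0 ->
     a31 = (6 * a * nu - 3 * nu + a) / (3 * a) ->
     a32 = nu / a ->
     b1 = (- 12 * a * nu - 6 * nu + a + 1) / (6 * a) ->
     b2 = (- 18 * a * nu - 6 * nu + 1) / (6 * a * (3 * a - 1)) ->
     b3 = (12 * nu + 3 * a - 2) / (2 * (3 * a - 1)) ->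
     let c3 := a31 + a32 in
     c3 = (6 * nu + 1) / 3 /\
     forall e1 e2 e3 e4 : R,
       e1 + e2 + e3 + e4 = 1 ->
       a * e2 + c3 * e3 + e4 = 1 / 2 ->
       has_order 2 (cf_embedded_scheme a a31 a32 b1 b2 b3 e1 e2 e3 e4) /\
       is_embedded_pair 3 2 (cf_scheme a a31 a32 b1 b2 b3)
         (cf_embedded_scheme a a31 a32 b1 b2 b3 e1 e2 e3 e4)).
Proof.
have a0 : a != 0 by exact/eqP.
have a3 : 3 * a - 1 != 0 by apply/eqP => h; apply: ha3; lra.
split=> [a31 a32 b1 b2 b3|nu _ _ _ _ _ q -> -> -> -> -> c3].
  split=> [/order3_conditions /= [c1 c2 cw cx cvu]|[nu [q [-> [-> [-> [-> ->]]]]]]].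
    have [q e31 e1 e2 e3] := family_of_conditions a0 a3 c1 c2 cw cx cvu.
    (* The parameter is recovered from the coefficients as [a32 * a]. *)
    by exists (a32 * a); rewrite mulfK.
  by have [] := family_order a0 a3 q.
split; first exact: family_c3.
move=> e1 e2 e3 e4 s1 s2; have [H3 H2] := family_order a0 a3 q;
  have {}H2 := H2 _ _ _ _ s1 s2.
by split=> //; split.
Qed.
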